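(* There exist bounded domains $\Omega$ in $\mathbb{C}^2$ such that, for $p\in(1,\infty)$, the ordinary Bergman projection $\mathbf{B}_\Omega$ is bounded on $L^p(\Omega)$ only for $p=2$.
   Context: For a domain $\Omega\subset\mathbb{C}^n$, $L^p(\Omega)$ is taken with respect to Lebesgue measure, $L^2_a(\Omega)$ is the closed subspace of holomorphic functions in $L^2(\Omega)$, and the ordinary Bergman projection $\mathbf{B}_\Omega:L^2(\Omega)\to L^2_a(\Omega)$ is the orthogonal projection. It is said to be bounded on $L^p(\Omega)$ if there is $C>0$ with $\|\mathbf{B}_{\Omega}f\|_{L^p(\Omega)}\le C\|f\|_{L^p(\Omega)}$ for all $f\in L^2(\Omega)\cap L^p(\Omega)$. *)

(* Defs.v *)
From HB Require Import structures.
From mathcomp Require Import all_boot all_order all_algebra.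
From mathcomp Require Import complex.
From mathcomp Require Import all_classical all_reals all_analysis.

Set Implicit Arguments.
Unset Strict Implicit.
Unset Printing Implicit Defensive.
Import Order.TTheory GRing.Theory Num.Theory.
Import numFieldNormedType.Exports.

Local Open Scope classical_set_scope.
Local Open Scope ring_scope.
Local Open Scope complex_scope.

(* R[i] seen as a numClosedFieldType, so that the topology, norm and
   C-differentiability of MathComp-Analysis apply to CC R and CC R * CC R. *)
Definition CC (R : realType) : numClosedFieldType := R[i].

Definition C2 (R : realType) : normedModType (CC R) := (CC R * CC R)%type.

Definition leb2 (R : realType) :
    set (measurableTypeR R * measurableTypeR R) -> \bar R :=
  (@lebesgue_measure R \x @lebesgue_measure R)%E.

HB.instance Definition _ (R : realType) := Measure.on (@leb2 R).

Lemma leb2_sigma_finite (R : realType) : sigma_finite setT (@leb2 R).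
Proof.
have /sigma_finiteP[F [TF ndF Foo]] := sigma_finiteT (@lebesgue_measure R).
exists (fun n => F n `*` F n).
  rewrite -setXTT TF predeqE => -[x y]; split.
    move=> [/= [n _ Fnx] [k _ Fky]]; exists (maxn n k) => //; split.
    - by move: x Fnx; exact/subsetPset/ndF/leq_maxl.
    - by move: y Fky; exact/subsetPset/ndF/leq_maxr.
  by move=> [n _ []/= ? ?]; split; exists n.
move=> k; have [? ?] := Foo k; split; first exact: measurableX.
by rewrite /leb2 product_measure1E// lte_mul_pinfty// ge0_fin_numE.
Qed.

HB.instance Definition _ (R : realType) :=
  Measure_isSigmaFinite.Build _ _ _ (@leb2 R) (@leb2_sigma_finite R).

Notation R4 R :=
  ((measurableTypeR R * measurableTypeR R) *
   (measurableTypeR R * measurableTypeR R))%type.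

Definition leb4 (R : realType) : set (R4 R) -> \bar R :=
  (@leb2 R \x @leb2 R)%E.

HB.instance Definition _ (R : realType) := Measure.on (@leb4 R).

Definition toC2 (R : realType) (x : R4 R) : C2 R :=
  (x.1.1 +i* x.1.2, x.2.1 +i* x.2.2).

(* Lebesgue measure on C^2 is leb4 transported along the bijection toC2:
   a subset of C^2 is handled through its real coordinates. *)
Definition real_coords (R : realType) (Omega : set (C2 R)) : set (R4 R) :=
  @toC2 R @^-1` Omega.

Definition bounded_domain (R : realType) (Omega : set (C2 R)) : Prop :=
  [/\ open Omega, connected Omega, Omega !=set0 & bounded_set Omega].

Definition holomorphic_on (R : realType) (Omega : set (C2 R))
    (f : C2 R -> CC R) : Prop :=
  forall z, Omega z -> differentiable f z.

Definition measurable_on (R : realType) (Omega : set (C2 R))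
    (f : C2 R -> CC R) : Prop :=
  measurable_fun (real_coords Omega) (fun x => complex.Re (f (toC2 x))) /\
  measurable_fun (real_coords Omega) (fun x => complex.Im (f (toC2 x))).

(* Functions on Omega are represented by functions on C^2 whose values
   outside Omega are irrelevant: the patch sets them to 0. *)
Definition LpNorm (R : realType) (Omega : set (C2 R)) (p : R)
    (f : C2 R -> CC R) : \bar R :=
  'N[@leb4 R]_(p%:E)[
    EFin \o patch (cst 0) (real_coords Omega)
                  (fun x => Normc.normc (f (toC2 x)))].

Definition Lp (R : realType) (Omega : set (C2 R)) (p : R) :
    set (C2 R -> CC R) :=
  [set f | measurable_on Omega f /\ (LpNorm Omega p f < +oo)%E].

Definition bergman_space (R : realType) (Omega : set (C2 R)) :
    set (C2 R -> CC R) :=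
  [set f | holomorphic_on Omega f /\ Lp Omega 2 f].

Definition Cintegral (R : realType) (Omega : set (C2 R))
    (f : C2 R -> CC R) : CC R :=
  (\int[@leb4 R]_(x in real_coords Omega) complex.Re (f (toC2 x)))%R +i*
  (\int[@leb4 R]_(x in real_coords Omega) complex.Im (f (toC2 x)))%R.

Definition L2dot (R : realType) (Omega : set (C2 R))
    (f g : C2 R -> CC R) : CC R :=
  Cintegral Omega (fun z => f z * (g z)^*).

Definition is_bergman_projection (R : realType) (Omega : set (C2 R))
    (f g : C2 R -> CC R) : Prop :=
  bergman_space Omega g /\
  forall h, bergman_space Omega h -> L2dot Omega (fun z => f z - g z) h = 0.

(* For Omega open and f in L^2(Omega) such a g exists and is unique on Omega
   (its values outside Omega are irrelevant), so the default is not used. *)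
Definition bergman_projection (R : realType) (Omega : set (C2 R))
    (f : C2 R -> CC R) : C2 R -> CC R :=
  xget (cst 0) [set g | is_bergman_projection Omega f g].

Definition bergman_bounded (R : realType) (Omega : set (C2 R)) (p : R) :
    Prop :=
  exists C : R, 0 < C /\
    forall f, Lp Omega 2 f -> Lp Omega p f ->
      (LpNorm Omega p (bergman_projection Omega f)
         <= C%:E * LpNorm Omega p f)%E.

(* Main.v *)
(* The domain is the punctured irrational Hartogs triangle
   { 0 < |z1| < |z2|^al, |z2| < 1 } with al = sqrt 2.  Its monomials
   e = z1^a / z2^m, of weighted degree t = al a - m, satisfy a scaling law under
   (z1, z2) |-> (l^al z1, l z2): the integral of |e|^q over the part |z2| < l is
   l^(q t + 2 (1 + al)) times the whole integral.  Hence e is in L^q exactly when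
   q t + 2 (1 + al) > 0.  As al is irrational, t can be chosen arbitrarily close
   to -(1 + al) from the right.

   If h is in the Bergman space, h / e is holomorphic and its means over the tori
   of the domain are all equal, by Goursat's theorem in logarithmic polar
   coordinates.  So a torus-invariant truncation e 1_K projects to c e, with
   c = int_K |e|^2 / int |e|^2.  For p > 2 take t with e in L^2 but not in L^p,
   and K = {|z2| >= 1/2}, where e is bounded.  For p < 2 take K = {|z2| < l}: the
   norm ratio is l^(t + 2 (1 + al) (1 - 1/p)), unbounded as l -> 0 for suitable t.
   For p = 2 the projection is a contraction. *)
From HB Require Import structures.
Require Import Defs.
From mathcomp Require Import all_boot all_order all_algebra.
From mathcomp Require Import complex.
From mathcomp Require Import all_classical all_reals all_analysis.
From mathcomp Require Import measurable_realfun ring lra.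

Set Implicit Arguments.
Unset Strict Implicit.
Unset Printing Implicit Defensive.
Import Order.TTheory GRing.Theory Num.Theory.
Import numFieldNormedType.Exports.

Local Open Scope classical_set_scope.
Local Open Scope ring_scope.

(** The projection of a truncated monomial is guessed and then certified by its defining
    orthogonality. Removing [z1 = 0] from the triangle makes [e] zero-free, so an arbitrary [h] of
    the Bergman space can be divided by [e]. The real part of the pairing of [e 1_K - c e] with [h]
    becomes the integral of [W] times the real part of [h / e], where the weight
    [W = (1_K - c) |e|^2] is torus-invariant and, by the choice of [c], has integral 0. Rotations
    preserve Lebesgue measure, so averaging over the torus replaces the real part of [h / e] by a
    constant and the pairing vanishes; the imaginary part follows on replacing [h] by [i h].
    Irrationality is what reaches every exponent: for rational [al] the degrees [al a - m] form a
    discrete set, and the gap above [-(1 + al)] would put a whole interval of [p] around 2 out of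
    reach of these test functions. *)

(** * Maps that multiply Lebesgue measure by a constant *)

Section dilation.
Local Open Scope ereal_scope.
Context (R : realType).

(** For an invertible linear [T], [c] is the inverse of the absolute Jacobian. Stating the property
    on integrals of nonnegative functions rather than on sets lets it compose directly and pass
    through Tonelli one coordinate at a time. *)
Definition dilates d (X : measurableType d) (mu : set X -> \bar R) (c : R)
    (T : X -> X) : Prop :=
  measurable_fun setT T /\
  forall f : X -> \bar R, measurable_fun setT f -> (forall x, 0 <= f x) ->
    \int[mu]_x f (T x) = c%:E * \int[mu]_x f x.

Lemma dilates_comp d (X : measurableType d) (mu : set X -> \bar R) c c' T T' :
  dilates mu c T -> dilates mu c' T' -> dilates mu (c * c')%R (T' \o T).
Proof.
move=> [mT iT] [mT' iT']; split; first exact: measurableT_comp.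
move=> f mf f0; rewrite (iT (f \o T')).
- by rewrite iT'// EFinM muleA.
- exact: measurableT_comp mf mT'.
- by move=> x; exact: f0.
Qed.

(** The pushforward under [T], divided by [c], agrees with Lebesgue measure on half-open intervals,
    hence everywhere by uniqueness. *)
Lemma lebesgue_measure_dilates (c : R) (T : R -> R) :
  measurable_fun setT (T : measurableTypeR R -> measurableTypeR R) ->
  (0 < c)%R ->
  (forall a b, lebesgue_measure (T @^-1` `]a, b]%classic) =
    c%:E * lebesgue_measure `]a, b]%classic) ->
  dilates (@lebesgue_measure R) c T.
Proof.
move=> mT c0 Tab; split => // f mf f0.
pose phi : measurableTypeR R -> measurableTypeR R := T.
have mphi : measurable_fun setT phi by [].
have c10 : (0 <= c^-1)%R by rewrite invr_ge0 ltW.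
pose nu := measure_function_pushforward__canonical__measure_function_Measure
  (@lebesgue_measure R) mphi.
rewrite [in RHS](eq_measure_integral (mscale (NngNum c10) nu)) => [|A mA _].
  rewrite ge0_integral_mscale//= muleA -EFinM divff ?gt_eqF// mul1e.
  by rewrite (ge0_integral_pushforward mphi).
apply: lebesgue_measure_unique mA => _ [[a b] _ <-] /=.
rewrite /mscale/= /pushforward.
by rewrite [X in _ = _ * X]Tab muleA -EFinM mulVf ?gt_eqF// mul1e.
Qed.

Lemma lebesgue_translation (t : R) :
  dilates (@lebesgue_measure R) 1 (fun x => x + t)%R.
Proof.
apply: lebesgue_measure_dilates => // [|a b].
  by apply: measurable_funD.
rewrite (_ : _ @^-1` _ = `]a - t, b - t]%classic)%R; last first.
  by apply/seteqP; split => x /=; rewrite !in_itv/= ltrBlDr lerBrDr.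
rewrite mul1e !lebesgue_measure_itv/= !lte_fin ltrD2r; case: ifP => // _.
by rewrite -!EFinB; congr EFin; ring.
Qed.

Lemma lebesgue_scaling (l : R) : (0 < l)%R ->
  dilates (@lebesgue_measure R) l^-1 (fun x => l * x)%R.
Proof.
move=> l0; apply: lebesgue_measure_dilates => // [||a b].
- by apply: measurable_funM.
- by rewrite invr_gt0.
rewrite (_ : _ @^-1` _ = `]l^-1 * a, l^-1 * b]%classic)%R; last first.
  apply/seteqP; split => x /=; rewrite !in_itv/=.
    by rewrite ltr_pdivrMl// ler_pdivlMl.
  by rewrite ltr_pdivrMl// ler_pdivlMl.
rewrite !lebesgue_measure_itv/= !lte_fin ltr_pM2l ?invr_gt0//.
case: ifP => // _; last by rewrite mule0.
by rewrite -!EFinB -EFinM; congr EFin; ring.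
Qed.

Section fiberwise.
Context d1 d2 (X : measurableType d1) (Y : measurableType d2).
Variables (m1 : {sigma_finite_measure set X -> \bar R}).
Variables (m2 : {sigma_finite_measure set Y -> \bar R}).

(** Tonelli integrates the first coordinate first, with the second one as a parameter on which [T]
    may depend. This is what makes shears available. *)
Lemma dilates_fiber1 (c : R) (T : X * Y -> X) : (0 <= c)%R ->
  measurable_fun setT T -> (forall y, dilates m1 c (fun x => T (x, y))) ->
  dilates (m1 \x m2) c (fun z => (T z, z.2)).
Proof.
move=> c0 mT iT; have mTT : measurable_fun setT (fun z => (T z, z.2)).
  exact: measurable_fun_pair.
split => // f mf f0.
rewrite fubini_tonelli2//; last exact: measurableT_comp mf mTT.
rewrite fubini_tonelli2// -ge0_integralZl//; last 2 first.
- exact: measurable_fun_fubini_tonelli_G.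
- by move=> y _; exact: integral_ge0.
apply: eq_integral => y _; rewrite /fubini_G /=.
apply: (iT y).2 (fun x => f (x, y)) _ _ => //.
exact: measurableT_comp.
Qed.

Lemma dilates_fiber2 (c : R) (T : X * Y -> Y) : (0 <= c)%R ->
  measurable_fun setT T -> (forall x, dilates m2 c (fun y => T (x, y))) ->
  dilates (m1 \x m2) c (fun z => (z.1, T z)).
Proof.
move=> c0 mT iT; have mTT : measurable_fun setT (fun z => (z.1, T z)).
  exact: measurable_fun_pair.
split => // f mf f0.
rewrite fubini_tonelli1//; last exact: measurableT_comp mf mTT.
rewrite fubini_tonelli1// -ge0_integralZl//; last 2 first.
- exact: measurable_fun_fubini_tonelli_F.
- by move=> y _; exact: integral_ge0.
apply: eq_integral => x _; rewrite /fubini_F /=.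
apply: (iT x).2 (fun y => f (x, y)) _ _ => //.
exact: measurableT_comp.
Qed.

Lemma dilates_prod (c1 c2 : R) (T1 : X -> X) (T2 : Y -> Y) :
  (0 <= c1)%R -> (0 <= c2)%R -> dilates m1 c1 T1 -> dilates m2 c2 T2 ->
  dilates (m1 \x m2) (c1 * c2)%R (fun z => (T1 z.1, T2 z.2)).
Proof.
move=> c10 c20 iT1 iT2.
apply: (@dilates_comp _ _ _ _ _ (fun z => (T1 z.1, z.2))
  (fun z => (z.1, T2 z.2))).
  apply: dilates_fiber1 => //; exact: measurableT_comp iT1.1 measurable_fst.
apply: dilates_fiber2 => //; exact: measurableT_comp iT2.1 measurable_snd.
Qed.

End fiberwise.

Notation mR2 := (measurableTypeR R * measurableTypeR R)%type.

Definition rot2 (c s : R) (x : mR2) : mR2 :=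
  (c * x.1 - s * x.2, s * x.1 + c * x.2)%R.

Lemma leb2_shear1 (t : R) :
  dilates (@leb2 R) 1 (fun x : mR2 => (x.1 + t * x.2, x.2))%R.
Proof.
apply: (@dilates_fiber1 _ _ _ _ lebesgue_measure lebesgue_measure 1
  (fun z => z.1 + t * z.2)%R) => //.
- by apply: measurable_funD => //; apply: measurable_funM.
- by move=> y; exact: (lebesgue_translation (t * y)).
Qed.

Lemma leb2_shear2 (t : R) :
  dilates (@leb2 R) 1 (fun x : mR2 => (x.1, x.2 + t * x.1))%R.
Proof.
apply: (@dilates_fiber2 _ _ _ _ lebesgue_measure lebesgue_measure 1
  (fun z => z.2 + t * z.1)%R) => //.
- by apply: measurable_funD => //; apply: measurable_funM.
- by move=> y; exact: (lebesgue_translation (t * y)).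
Qed.

(* A rotation other than the half-turn is a product of three shears. *)
Lemma leb2_rot (c s : R) : (c ^+ 2 + s ^+ 2 = 1)%R ->
  dilates (@leb2 R) 1 (rot2 c s).
Proof.
have main (a b : R) : (a ^+ 2 + b ^+ 2 = 1)%R -> (1 + a != 0)%R ->
    dilates (@leb2 R) 1 (rot2 a b).
  move=> ab a1; have [t [tb ta]] : exists t, (t * b = 1 - a /\ t * (1 + a) = b)%R.
    (* The tangent of the half-angle, which exists unless [a = -1]. *)
    exists (b / (1 + a))%R; split; last by field.
    have -> : (b / (1 + a) * b = b ^+ 2 / (1 + a))%R by field.
    by have -> : (b ^+ 2 = (1 - a) * (1 + a))%R by [apply: (addrI (a ^+ 2)%R); rewrite ab; ring]; field.
  have := dilates_comp (dilates_comp (leb2_shear1 (- t)) (leb2_shear2 b))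
    (leb2_shear1 (- t)).
  rewrite !mul1r; congr dilates; apply/funext => -[x y]; rewrite /rot2/=.
  congr (_, _).
    transitivity ((1 - t * b) * x - (t * (2 - t * b)) * y)%R; first by ring.
    by rewrite tb; rewrite -[in RHS]ta; ring.
  transitivity (b * x + (1 - t * b) * y)%R; first by ring.
  by rewrite tb; ring.
move=> cs; have [c1|c1] := eqVneq (1 + c)%R 0%R; last exact: main.
have cE : (c = -1)%R by lra.
have sE : (s = 0)%R.
  by apply/eqP; rewrite -sqrf_eq0; apply/eqP; move: cs; rewrite cE; lra.
(* The half-turn is the square of the quarter-turn, which the shears do cover. *)
have q : dilates (@leb2 R) 1 (rot2 0 1).
  by apply: main; rewrite ?expr0n ?expr1n ?add0r ?addr0// oner_neq0.
have := dilates_comp q q; rewrite mul1r; congr dilates.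
by apply/funext => -[x y]; rewrite /rot2/= cE sE; congr (_, _); ring.
Qed.

Lemma leb2_scale (l : R) : (0 < l)%R ->
  dilates (@leb2 R) (l ^- 2)%R (fun x : mR2 => (l * x.1, l * x.2))%R.
Proof.
move=> l0; rewrite -exprVn expr2.
by apply: (@dilates_prod _ _ _ _ lebesgue_measure lebesgue_measure);
  rewrite ?invr_ge0 ?ltW//; exact: lebesgue_scaling.
Qed.

Lemma leb4_prod (c1 c2 : R) (T1 T2 : mR2 -> mR2) :
  (0 <= c1)%R -> (0 <= c2)%R ->
  dilates (@leb2 R) c1 T1 -> dilates (@leb2 R) c2 T2 ->
  dilates (@leb4 R) (c1 * c2)%R (fun z => (T1 z.1, T2 z.2)).
Proof. exact: (@dilates_prod _ _ _ _ (@leb2 R) (@leb2 R)). Qed.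

End dilation.

(** * Integrals of continuous functions over segments *)

Section interval_integral.
Context (R : realType).
Implicit Types (f g : R -> R) (a b : R).

Definition segint f a b : R := (\int[lebesgue_measure]_(x in `[a, b]) f x)%R.

Definition ctn f a b : Prop := forall x, a <= x <= b -> {for x, continuous f}.

Lemma ctnS f a b a' b' : a <= a' -> b' <= b -> ctn f a b -> ctn f a' b'.
Proof.
move=> aa bb cf x /andP[ax xb]; apply: cf.
by rewrite (le_trans aa ax) (le_trans xb bb).
Qed.

Lemma ctn_integrable f a b : ctn f a b ->
  (@lebesgue_measure R).-integrable `[a, b] (EFin \o f).
Proof.
move=> cf; apply: continuous_compact_integrable; first exact: segment_compact.
by apply: continuous_in_subspaceT => x /[!inE]/=; rewrite in_itv/=; exact: cf.
Qed.

Lemma segint_split f a m b : a <= m -> m <= b -> ctn f a b ->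
  segint f a b = segint f a m + segint f m b.
Proof.
move=> am mb cf; have := @Rintegral_itvB R f (BLeft a) (BRight b) m
  (ctn_integrable cf).
rewrite !bnd_simp => /(_ am mb) /eqP; rewrite subr_eq => /eqP.
rewrite /segint => ->; rewrite addrC Rintegral_itv_obnd_cbnd//.
have : ctn f m b by apply: ctnS cf.
move/ctn_integrable; apply: integrableS => //.
by apply: subset_itvr; rewrite bnd_simp.
Qed.

Lemma segintB f g a b : ctn f a b -> ctn g a b ->
  segint (fun x => f x - g x) a b = segint f a b - segint g a b.
Proof. by move=> cf cg; rewrite /segint RintegralB//; exact: ctn_integrable. Qed.

Lemma segint_cst r a b : a <= b -> segint (fun=> r) a b = r * (b - a).
Proof.
move=> ab; rewrite /segint Rintegral_cst//= lebesgue_measure_itv/= lte_fin.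
case: ltP => //= ba; rewrite (_ : b = a) ?subrr//.
by apply/eqP; rewrite eq_le ab ba.
Qed.

Lemma segint_dist f a b k e : a <= b -> ctn f a b ->
  (forall x, a <= x <= b -> `|f x - k| <= e) ->
  `|segint f a b - k * (b - a)| <= e * (b - a).
Proof.
move=> ab cf fk; have cc r : ctn (fun=> r) a b by move=> x _; exact: cst_continuous.
rewrite -!segint_cst// -segintB//.
have cfk : ctn (fun x => f x - k) a b.
  by move=> x xab; apply: continuousB; [exact: cf|exact: cst_continuous].
apply: (le_trans (le_normr_Rintegral _ (ctn_integrable cfk))) => //.
apply: le_Rintegral => //.
- exact: integrable_norm (ctn_integrable cfk).
- exact: (ctn_integrable (cc e)).
Qed.

End interval_integral.

(** * Goursat's theorem for divergence-free fields on rectangles *)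

Section goursat.
Context (R : realType).
Implicit Types (Q P : R -> R -> R).

(* Differentiability of the field (Q, P) with zero divergence; for a holomorphic
   function this is applied to (Re, -Im). *)
Definition divfree Q P (u0 t0 : R) : Prop :=
  exists al be ga : R, forall e : R, 0 < e -> exists2 d : R, 0 < d &
    forall u t, `|u - u0| < d -> `|t - t0| < d ->
    `|Q u t - Q u0 t0 - (al * (u - u0) + be * (t - t0))|
      <= e * (`|u - u0| + `|t - t0|) /\
    `|P u t - P u0 t0 - (ga * (u - u0) - al * (t - t0))|
      <= e * (`|u - u0| + `|t - t0|).

Lemma diff_cvg (f : R -> R) x (l : R) :
  (forall e : R, 0 < e -> exists2 d : R, 0 < d & forall y, `|y - x| < d ->
     `|f y - f x - l * (y - x)| <= e * `|y - x|) -> {for x, continuous f}.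
Proof.
move=> df; apply/cvgrPdist_le => e e0.
have [d d0 /= fd] := df 1 ltr01.
have L0 : 0 < 1 + `|l| by rewrite ltr_pwDl.
apply/nbhs_normP; exists (Num.min d (e / (1 + `|l|))) => /=.
  by rewrite lt_min d0 divr_gt0.
move=> y /=; rewrite distrC lt_min => /andP[yd ye].
have := fd y yd; rewrite mul1r => h.
rewrite distrC -[X in `|X|](subrK (l * (y - x))).
apply: (le_trans (ler_normD _ _)).
apply: (le_trans (lerD h (lexx _))).
by rewrite normrM -[X in X + _]mul1r -mulrDl mulrC -ler_pdivlMr// ltW.
Qed.

Lemma divfree_ctn1 Q P u t : divfree Q P u t ->
  {for u, continuous (Q^~ t)} /\ {for u, continuous (P^~ t)}.
Proof.
move=> [al [be [ga D]]]; split.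
  apply: (@diff_cvg _ _ al) => e /D[d d0 h]; exists d => // y yd.
  have [] := h y t yd; first by rewrite subrr normr0.
  by rewrite subrr !mulr0 !addr0 normr0 addr0 => + _.
apply: (@diff_cvg _ _ ga) => e /D[d d0 h]; exists d => // y yd.
have [] := h y t yd; first by rewrite subrr normr0.
by rewrite subrr !mulr0 !subr0 normr0 !addr0 => _.
Qed.

Lemma divfree_ctn2 Q P u t : divfree Q P u t ->
  {for t, continuous (Q u)} /\ {for t, continuous (P u)}.
Proof.
move=> [al [be [ga D]]]; split.
  apply: (@diff_cvg _ _ be) => e /D[d d0 h]; exists d => // y yd.
  have [] := h u y _ yd; first by rewrite subrr normr0.
  by rewrite subrr !mulr0 !add0r normr0 !add0r => + _.
apply: (@diff_cvg _ _ (- al)) => e /D[d d0 h]; exists d => // y yd.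
have [] := h u y _ yd; first by rewrite subrr normr0.
by rewrite subrr !mulr0 !add0r normr0 !add0r mulNr => _.
Qed.

(** Outward flux of the field with components [Q] (along [u]) and [P] (along [t]) through the
    boundary of the rectangle: right side minus left side, plus top minus bottom. *)
Definition flux Q P (a b c d : R) : R :=
  segint (Q b) c d - segint (Q a) c d +
  (segint (P^~ d) a b - segint (P^~ c) a b).

Definition divfree_on Q P (a b c d : R) : Prop :=
  forall u t, a <= u <= b -> c <= t <= d -> divfree Q P u t.

Section flux.
Variables (Q P : R -> R -> R) (a b c d : R).
Hypothesis D : divfree_on Q P a b c d.

Lemma divfree_on_ctn1 t : c <= t <= d -> ctn (Q^~ t) a b /\ ctn (P^~ t) a b.
Proof. by move=> ht; split => u hu; have [] := divfree_ctn1 (D hu ht). Qed.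

Lemma divfree_on_ctn2 u : a <= u <= b -> ctn (Q u) c d /\ ctn (P u) c d.
Proof. by move=> hu; split => t ht; have [] := divfree_ctn2 (D hu ht). Qed.

Lemma flux_split1 m : a <= m -> m <= b -> c <= d ->
  flux Q P a b c d = flux Q P a m c d + flux Q P m b c d.
Proof.
move=> am mb cd; rewrite /flux.
rewrite (segint_split am mb (divfree_on_ctn1 _).2) ?cd ?lexx//.
rewrite (segint_split am mb (divfree_on_ctn1 _).2) ?cd ?lexx//.
ring.
Qed.

Lemma flux_split2 m : c <= m -> m <= d -> a <= b ->
  flux Q P a b c d = flux Q P a b c m + flux Q P a b m d.
Proof.
move=> cm md ab; rewrite /flux.
rewrite (segint_split cm md (divfree_on_ctn2 _).1) ?ab ?lexx//.
rewrite (segint_split cm md (divfree_on_ctn2 _).1) ?ab ?lexx//.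
ring.
Qed.

(* The affine part of a divergence-free field has zero flux. *)
Lemma flux_small u0 t0 al be ga e : a <= b -> c <= d ->
  (forall u t, a <= u <= b -> c <= t <= d ->
    `|Q u t - Q u0 t0 - (al * (u - u0) + be * (t - t0))| <= e /\
    `|P u t - P u0 t0 - (ga * (u - u0) - al * (t - t0))| <= e) ->
  `|flux Q P a b c d| <= 2 * e * (b - a + (d - c)).
Proof.
move=> ab cd QP.
have [hbb haa] : a <= b <= b /\ a <= a <= b by rewrite ab !lexx.
have [hdd hcc] : c <= d <= d /\ c <= c <= d by rewrite cd !lexx.
rewrite /flux -segintB ?(divfree_on_ctn2 _).1//; last 2 first.
- exact: (divfree_on_ctn2 hbb).1.
- exact: (divfree_on_ctn2 haa).1.
rewrite -segintB; last 2 first.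
- exact: (divfree_on_ctn1 hdd).2.
- exact: (divfree_on_ctn1 hcc).2.
(* Each difference of opposite sides is constant up to [2 * e]. The two constants contribute
   [al * (b - a) * (d - c)] with opposite signs and cancel. *)
have /= I1 : `|segint (fun x => Q b x - Q a x) c d - al * (b - a) * (d - c)|
    <= 2 * e * (d - c).
  apply: segint_dist => // [t ht|t ht].
    apply: continuousB; first exact: (divfree_on_ctn2 hbb).1.
    exact: (divfree_on_ctn2 haa).1.
  have [h1 _] := QP _ _ hbb ht; have [h2 _] := QP _ _ haa ht.
  move: h1 h2; rewrite !ler_norml => /andP[? ?] /andP[? ?].
  by apply/andP; split; lra.
have /= I2 : `|segint (fun x => P x d - P x c) a b - - al * (d - c) * (b - a)|
    <= 2 * e * (b - a).
  apply: segint_dist => // [u hu|u hu].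
    apply: continuousB; first exact: (divfree_on_ctn1 hdd).2.
    exact: (divfree_on_ctn1 hcc).2.
  have [_ h1] := QP _ _ hu hdd; have [_ h2] := QP _ _ hu hcc.
  move: h1 h2; rewrite !ler_norml => /andP[? ?] /andP[? ?].
  by apply/andP; split; lra.
move: I1 I2; set I1 := segint _ _ _; set I2 := segint _ _ _ => h1 h2.
have -> : I1 + I2 = (I1 - al * (b - a) * (d - c)) +
   (I2 - - al * (d - c) * (b - a)) by ring.
apply: (le_trans (ler_normD _ _)); apply: (le_trans (lerD h1 h2)).
by rewrite -mulrDr addrC.
Qed.

End flux.

Lemma divfree_onS Q P a b c d a' b' c' d' : a <= a' -> b' <= b -> c <= c' ->
  d' <= d -> divfree_on Q P a b c d -> divfree_on Q P a' b' c' d'.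
Proof.
move=> aa bb cc dd D u t /andP[au ub] /andP[ct td]; apply: D.
  by rewrite (le_trans aa au) (le_trans ub bb).
by rewrite (le_trans cc ct) (le_trans td dd).
Qed.

(** The fluxes of the four quarters add up to the whole, so one of them carries at least a quarter
    of its absolute value. Giving the quarter by a corner and exact half-sides keeps the side
    lengths explicit under iteration. *)
Lemma flux_halving Q P a b c d (h := (b - a) / 2) (k := (d - c) / 2) :
  divfree_on Q P a b c d -> a <= b -> c <= d ->
  exists x y, [/\ a <= x, x + h <= b, c <= y, y + k <= d &
    `|flux Q P a b c d| <= 4 * `|flux Q P x (x + h) y (y + k)|].
Proof.
move=> D ab cd.
have h0 : 0 <= h by rewrite divr_ge0// subr_ge0.
have k0 : 0 <= k by rewrite divr_ge0// subr_ge0.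
have bE : b = a + h + h by rewrite /h; field.
have dE : d = c + k + k by rewrite /k; field.
have ah : a <= a + h by rewrite lerDl.
have hb : a + h <= b by rewrite bE lerDl.
have ck : c <= c + k by rewrite lerDl.
have kd : c + k <= d by rewrite dE lerDl.
have [|n1] := leP `|flux Q P a b c d| (4 * `|flux Q P a (a + h) c (c + k)|).
  by exists a, c; split.
have [|n2] := leP `|flux Q P a b c d|
    (4 * `|flux Q P (a + h) (a + h + h) c (c + k)|).
  by exists (a + h), c; split; rewrite // -bE.
have [|n3] := leP `|flux Q P a b c d|
    (4 * `|flux Q P a (a + h) (c + k) (c + k + k)|).
  by exists a, (c + k); split; rewrite // -dE.
exists (a + h), (c + k); split; rewrite -?bE -?dE//.
move: n1 n2 n3; rewrite -bE -dE.
rewrite (flux_split2 D ck kd ab).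
have -> : flux Q P a b c (c + k) = flux Q P a (a + h) c (c + k) +
    flux Q P (a + h) b c (c + k).
  by apply: flux_split1 => //; apply: divfree_onS D.
have -> : flux Q P a b (c + k) d = flux Q P a (a + h) (c + k) d +
    flux Q P (a + h) b (c + k) d.
  by apply: flux_split1 => //; apply: divfree_onS D.
move: (flux Q P a (a + h) c (c + k)) (flux Q P (a + h) b c (c + k))
  (flux Q P a (a + h) (c + k) d) (flux Q P (a + h) b (c + k) d) => x1 x2 x3 x4.
have := ler_normD (x1 + x2) (x3 + x4).
have := ler_normD x1 x2; have := ler_normD x3 x4.
lra.
Qed.

Lemma nested_segments (l u : nat -> R) :
  (forall n, l n <= l n.+1) -> (forall n, u n.+1 <= u n) ->
  (forall n, l n <= u n) -> exists x, forall n, l n <= x <= u n.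
Proof.
move=> l1 u1 lu.
have /nondecreasing_seqP lh := l1; have /nonincreasing_seqP uh := u1.
have lum n m : l m <= u n.
  by case: (leqP m n) => [/lh|/ltnW /uh] h; [exact: le_trans h (lu n)|
    exact: le_trans (lu m) h].
exists (sup (range l)) => n; apply/andP; split.
  by apply: ub_le_sup; [exists (u 0) => _ [m _ <-]|exists n].
by apply: ge_sup; [exists (l 0), 0|move=> _ [m _ <-]].
Qed.

Lemma dist_segment (l h x y : R) :
  l <= x -> x <= l + h -> l <= y -> y <= l + h -> `|x - y| <= h.
Proof. by move=> ? ? ? ?; rewrite ler_norml; apply/andP; split; lra. Qed.

Lemma exp2_small (h e : R) : 0 < e -> exists N, forall n, (N <= n)%N -> h / 2 ^+ n < e.
Proof.
move=> e0; exists (Num.bound (`|h| / e)) => n Nn.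
rewrite ltr_pdivrMr ?exprn_gt0// mulrC -ltr_pdivrMr//.
apply: le_lt_trans (_ : `|h| / e < _).
  by rewrite ler_pM2r ?invr_gt0// ler_norm.
apply: lt_le_trans (archi_boundP _) _; first by rewrite divr_ge0// ltW.
by rewrite -natrX ler_nat (leq_trans Nn)// ltnW// ltn_expl.
Qed.

(* Goursat's bisection argument: no continuity of the partial derivatives is
   assumed, so differentiation under the integral sign is not available. *)
Theorem flux_eq0 Q P a b c d : a <= b -> c <= d -> divfree_on Q P a b c d ->
  flux Q P a b c d = 0.
Proof.
move=> ab cd D; apply/eqP; rewrite -normr_le0 leNgt; apply/negP => F0.
set F := `|_| in F0.
pose h n : R := (b - a) / 2 ^+ n; pose k n : R := (d - c) / 2 ^+ n.
have hS n : h n.+1 = (h n) / 2 by rewrite /h exprSr invfM mulrA.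
have kS n : k n.+1 = (k n) / 2 by rewrite /k exprSr invfM mulrA.
have h0 n : 0 <= h n by rewrite divr_ge0 ?exprn_ge0// subr_ge0.
have k0 n : 0 <= k n by rewrite divr_ge0 ?exprn_ge0// subr_ge0.
pose fl n (z : R * R) := `|flux Q P z.1 (z.1 + h n) z.2 (z.2 + k n)|.
(* The invariant is a premise below the existential, so that [choice] yields a total successor
   function; where it fails any pair will do. *)
have step (s : nat * (R * R)) : exists z' : R * R,
    a <= s.2.1 -> s.2.1 + h s.1 <= b -> c <= s.2.2 -> s.2.2 + k s.1 <= d ->
    [/\ s.2.1 <= z'.1, z'.1 + h s.1.+1 <= s.2.1 + h s.1,
       s.2.2 <= z'.2, z'.2 + k s.1.+1 <= s.2.2 + k s.1 &
       fl s.1 s.2 <= 4 * fl s.1.+1 z'].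
  case: s => n [x y] /=.
  have [inv|ninv] := pselect [/\ a <= x, x + h n <= b, c <= y & y + k n <= d];
    last by exists (x, y) => *; exfalso; apply: ninv.
  have [ax xb cy yd] := inv.
  have [||x' [y' []]] :=
    @flux_halving Q P x (x + h n) y (y + k n) (divfree_onS ax xb cy yd D).
  - by rewrite lerDl.
  - by rewrite lerDl.
  have -> : (x + h n - x) / 2 = h n.+1 by rewrite hS addrC addKr.
  have -> : (y + k n - y) / 2 = k n.+1 by rewrite kS addrC addKr.
  by move=> xx xh yy yk le4; exists (x', y').
have [f fP] := choice step.
pose z := fix z n := if n is m.+1 then f (m, z m) else (a, c).
have inv n : [/\ a <= (z n).1, (z n).1 + h n <= b, c <= (z n).2,
    (z n).2 + k n <= d & F <= 4 ^+ n * fl n (z n)].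
  elim: n => [|n [ax xb cy yd le4]] /=.
    rewrite /h /k expr0 divr1 divr1 !lexx !(addrC _ (_ - _)) !subrK !lexx.
    by split => //; rewrite mul1r /fl/= /h /k expr0 !divr1 !(addrC _ (_ - _)) !subrK.
  have /= [// | // | // | // | x1 x2 y1 y2 le4'] := fP (n, z n).
  split; [exact: le_trans x1|exact: le_trans xb|exact: le_trans y1|
    exact: le_trans yd|].
  by rewrite exprSr -mulrA (le_trans le4)// ler_wpM2l// exprn_ge0.
have mono n : [/\ (z n).1 <= (z n.+1).1,
    (z n.+1).1 + h n.+1 <= (z n).1 + h n,
    (z n).2 <= (z n.+1).2 & (z n.+1).2 + k n.+1 <= (z n).2 + k n].
  have [ax xb cy yd _] := inv n.
  by have /= [// | // | // | // | x1 x2 y1 y2 _] := fP (n, z n).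
have [x0 x0P] : exists x, forall n, (z n).1 <= x <= (z n).1 + h n.
  apply: (@nested_segments (fun n => (z n).1) (fun n => (z n).1 + h n)) => n.
  - by have [] := mono n.
  - by have [] := mono n.
  - by rewrite lerDl.
have [y0 y0P] : exists x, forall n, (z n).2 <= x <= (z n).2 + k n.
  apply: (@nested_segments (fun n => (z n).2) (fun n => (z n).2 + k n)) => n.
  - by have [] := mono n.
  - by have [] := mono n.
  - by rewrite lerDl.
have [al [be [ga diff]]] : divfree Q P x0 y0.
  apply: D.
    have [ax xb _ _ _] := inv 0; have /andP[h1 h2] := x0P 0.
    by rewrite (le_trans ax h1) (le_trans h2 xb).
  have [_ _ ax xb _] := inv 0; have /andP[h1 h2] := y0P 0.
  by rewrite (le_trans ax h1) (le_trans h2 xb).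
pose S := b - a + (d - c).
have S0 : 0 <= S by rewrite addr_ge0// subr_ge0.
(* The [n]-th rectangle has flux at most [2 * e * s ^+ 2] with [s = S / 2 ^+ n]; the factor [4 ^+ n]
   restores [2 * e * S ^+ 2], and this [e] makes it smaller than [F]. The summand 1 keeps the
   quotient meaningful for a degenerate rectangle with [S = 0]. *)
pose e := F / (4 * (1 + S ^+ 2)).
have S2 : 0 < 1 + S ^+ 2 by rewrite ltr_pwDl// sqr_ge0.
have e0 : 0 < e by rewrite divr_gt0// mulr_gt0.
have [r r0 dr] := diff e e0.
have [N1 hN1] := exp2_small (b - a) r0; have [N2 hN2] := exp2_small (d - c) r0.
pose n := maxn N1 N2.
have hr : h n < r by apply: hN1; rewrite leq_maxl.
have kr : k n < r by apply: hN2; rewrite leq_maxr.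
have [ax xb cy yd le4] := inv n.
have /andP[x1 x2] := x0P n; have /andP[y1 y2] := y0P n.
pose s := h n + k n.
have sE : s = S / 2 ^+ n by rewrite /s /h /k -mulrDl.
have fle : fl n (z n) <= 2 * (e * s) * s.
  rewrite [X in _ * X](_ : s =
    (z n).1 + h n - (z n).1 + ((z n).2 + k n - (z n).2)); last by rewrite /s; ring.
  apply: (@flux_small _ _ _ _ _ _ (divfree_onS ax xb cy yd D) x0 y0 al be ga).
  - by rewrite lerDl.
  - by rewrite lerDl.
  move=> u t /andP[u1 u2] /andP[t1 t2].
  have ux := dist_segment u1 u2 x1 x2; have ty := dist_segment t1 t2 y1 y2.
  have [||Qle Ple] := dr u t; [exact: le_lt_trans hr|exact: le_lt_trans kr|].
  have es : e * (`|u - x0| + `|t - y0|) <= e * s.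
    by apply: ler_wpM2l; [exact: ltW|exact: lerD].
  by split; [exact: le_trans es|exact: le_trans es].
have : F <= 2 * e * S ^+ 2.
  apply: (le_trans le4).
  have -> : 2 * e * S ^+ 2 = 4 ^+ n * (2 * (e * s) * s).
    rewrite sE (_ : 4 = 2 ^+ 2); last by rewrite expr2; ring.
    by rewrite exprAC; field; rewrite expf_neq0.
  by rewrite ler_wpM2l ?exprn_ge0.
rewrite /e leNgt => /negP; apply.
rewrite (_ : _ * _ * _ = F * (S ^+ 2 / (2 * (1 + S ^+ 2)))); last first.
  by field; rewrite gt_eqF.
rewrite -[ltRHS]mulr1 ltr_pM2l// ltr_pdivrMr ?mulr_gt0// mul1r.
by apply: (@lt_trans _ _ (1 + S ^+ 2)); rewrite ?ltrDr// mulr_natl mulr2n ltrDl.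
Qed.

End goursat.

(** * From differentiability in two variables to complex derivatives in each *)

Section complex_differential.
Context (R : realType).
Local Notation C := (CC R).
Local Notation N := (@Normc.normc R).

Lemma normCE (z : C) : `|z| = ((N z)%:C)%C.
Proof. by case: z => a b; rewrite normc_def. Qed.

Lemma ltCR (x y : R) : ((x%:C)%C < (y%:C)%C :> C) = (x < y).
Proof. exact: ltcR. Qed.

Lemma leCR (x y : R) : ((x%:C)%C <= (y%:C)%C :> C) = (x <= y).
Proof. exact: lecR. Qed.

(** In the partial order of [CC R] a positive element has zero imaginary part, so the [CC R]-valued
    radii and tolerances of the normed space [C2 R] can be traded for real ones. *)
Lemma posCP (e : C) : 0 < e -> exists2 d : R, 0 < d & e = (d%:C)%C.
Proof.
case: e => a b; rewrite ltcE /= => /andP[/eqP b0 a0].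
by exists a => //; apply/eqP; rewrite eq_complex /= eqxx /= b0.
Qed.

Lemma differentiable_normc (V : normedModType C) (f : V -> C) (z : V) :
  differentiable f z ->
  forall e : R, 0 < e -> exists2 d : R, 0 < d &
    forall h : V, `|h| < (d%:C)%C ->
      `|f (h + z) - f z - 'd f z h| <= (e%:C)%C * `|h|.
Proof.
move=> /diff_locally/eqaddoP fo e e0; have /fo : 0 < (e%:C)%C :> C by rewrite ltCR.
move/nbhs_normP => [d /= /posCP[r r0 ->] dP]; exists r => // h hr.
have := dP h; rewrite /= sub0r normrN => /(_ hr).
by rewrite !fctE /= opprD addrA.
Qed.

(** Tolerances and moduli are real here, whereas the norm of [CC R] takes its values in [CC R]; the
    divergence-free fields derived from it are real. *)
Definition cdiff (f : C -> C) (z : C) : Prop :=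
  exists L : C, forall e : R, 0 < e -> exists2 d : R, 0 < d &
    forall w, N (w - z) < d -> N (f w - f z - L * (w - z)) <= e * N (w - z).

(** The increment [(w - z.1, 0)] is a complex multiple of [(1, 0)] and its max norm is the modulus
    of [w - z.1], so complex linearity of the differential gives the derivative as its value at
    [(1, 0)]. *)
Lemma differentiable_cdiff1 (f : C2 R -> C) (z : C2 R) :
  differentiable f z -> cdiff (fun w => f (w, z.2)) z.1.
Proof.
move=> df; exists ('d f z (1, 0)) => e e0.
have [d d0 dP] := differentiable_normc df e0; exists d => // w wd.
have nE : `|(w - z.1, 0) : C2 R| = ((N (w - z.1))%:C)%C.
  by rewrite prod_normE /= normr0 -normCE; apply: max_l.
have := dP (w - z.1, 0); rewrite nE ltCR => /(_ wd).
have -> : (w - z.1, 0) + z = (w, z.2) :> C2 R.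
  by apply: injective_projections => /=; rewrite ?subrK ?add0r.
have -> : (w - z.1, 0) = (w - z.1) *: ((1, 0) : C2 R) :> C2 R.
  by apply: injective_projections => /=; rewrite ?scaler0// -[LHS]mulr1.
rewrite linearZ normCE -rmorphM/= leCR.
by rewrite -[_ *: _]/(_ * _) mulrC -surjective_pairing.
Qed.

Lemma differentiable_cdiff2 (f : C2 R -> C) (z : C2 R) :
  differentiable f z -> cdiff (fun w => f (z.1, w)) z.2.
Proof.
move=> df; exists ('d f z (0, 1)) => e e0.
have [d d0 dP] := differentiable_normc df e0; exists d => // w wd.
have nE : `|(0, w - z.2) : C2 R| = ((N (w - z.2))%:C)%C.
  by rewrite prod_normE /= normr0 -normCE; apply: max_r.
have := dP (0, w - z.2); rewrite nE ltCR => /(_ wd).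
have -> : (0, w - z.2) + z = (z.1, w) :> C2 R.
  by apply: injective_projections => /=; rewrite ?subrK ?add0r.
have -> : (0, w - z.2) = (w - z.2) *: ((0, 1) : C2 R) :> C2 R.
  by apply: injective_projections => /=; rewrite ?scaler0// -[LHS]mulr1.
rewrite linearZ normCE -rmorphM/= leCR.
by rewrite -[_ *: _]/(_ * _) mulrC -surjective_pairing.
Qed.

End complex_differential.

(** * Logarithmic polar coordinates and the Cauchy-Riemann equations *)

Section polar.
Context (R : realType).
Local Notation C := (CC R).
Local Notation N := (@Normc.normc R).

(** The complex exponential of [u + i t]: [u] is the logarithm of the modulus, [t] an argument. *)
Definition cpol (u t : R) : C := (expR u * cos t +i* (expR u * sin t))%C.

Lemma normc_ge0 (z : C) : 0 <= N z.
Proof. by case: z => a b; exact: sqrtr_ge0. Qed.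

Lemma normc_ge_Re_Im (z : C) : `|complex.Re z| <= N z /\ `|complex.Im z| <= N z.
Proof.
case: z => a b /=; split; rewrite -sqrtr_sqr ler_sqrt ?addr_ge0 ?sqr_ge0//.
  by rewrite lerDl sqr_ge0.
by rewrite lerDr sqr_ge0.
Qed.

Lemma normc_le_Re_Im (a b : R) : N (a +i* b)%C <= `|a| + `|b|.
Proof.
rewrite /Normc.normc -[leRHS]ger0_norm ?addr_ge0// -sqrtr_sqr.
rewrite ler_sqrt ?sqr_ge0// sqrrD !real_normK ?num_real// -addrA lerD2l lerDr.
by rewrite mulrn_wge0// mulr_ge0.
Qed.

Lemma normc_cpol u t : N (cpol u t) = expR u.
Proof.
rewrite /cpol /Normc.normc !exprMn -mulrDr cos2Dsin2 mulr1 sqrtr_sqr ger0_norm // expR_ge0.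
Qed.

Lemma cpolD u v t s : cpol (u + v) (t + s) = cpol u t * cpol v s.
Proof.
apply/eqP; rewrite eq_complex; apply/andP; split; apply/eqP => /=.
  by rewrite expRD cosD; ring.
by rewrite expRD sinD; ring.
Qed.

Lemma is_derive_dist (f : R -> R) (x l : R) : is_derive x 1 f l ->
  forall e : R, 0 < e -> exists2 d : R, 0 < d &
    forall h, `|h| < d -> `|f (x + h) - f x - l * h| <= e * `|h|.
Proof.
move=> fl e e0; have df : differentiable f x.
  by apply/derivable1_diffP; exact: ex_derive.
have /diff_locally/eqaddoP/(_ _ e0)/nbhs_normP[d /= d0 dP] := df.
exists d => // h hd; have := dP h; rewrite /= sub0r normrN => /(_ hd).
rewrite !fctE /= opprD addrA (addrC h) -deriveE//.
suff -> : 'D_h f x = l * h by [].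
by rewrite deriveE// -[X in 'd f x X]mulr1 -[X in 'd f x X]/(h *: (1 : R)) linearZ
  -deriveE//= derive_val mulrC.
Qed.

(** The complex exponential has derivative 1 at 0; this is assembled from the derivatives at 0 of
    [expR], [cos] and [sin]. *)
Lemma cpol_dist0 (e : R) : 0 < e -> exists2 d : R, 0 < d &
  forall a b, `|a| < d -> `|b| < d ->
  N (cpol a b - 1 - (a +i* b)%C) <= e * (`|a| + `|b|).
Proof.
move=> e0; have e8 : 0 < e / 8 by lra.
have [d1 d10 exp1] := is_derive_dist (is_derive_expR 0) e8.
have [d2 d20 cos1] := is_derive_dist (is_derive_cos 0) e8.
have [d3 d30 sin1] := is_derive_dist (is_derive_sin 0) e8.
(* The bounds 1 and [e / 8] are there for the cross term [|a| |b|] coming from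
   [(expR a - 1) * sin b]. *)
exists (Num.min (Num.min d1 (Num.min d2 d3)) (Num.min 1 (e / 8))).
  by rewrite !lt_min d10 d20 d30 ltr01 e8.
move=> a b; rewrite !lt_min.
move=> /andP[/and3P[ad1 ad2 ad3] /andP[a1 ae]] /andP[/and3P[bd1 bd2 bd3] /andP[b1 be]].
have := exp1 _ ad1; have := cos1 _ bd2; have := sin1 _ bd3.
rewrite !add0r sin0 cos0 expR0 subr0 mul1r oppr0 mul0r subr0 mul1r.
move=> hs hc he.
have eq : cpol a b - 1 - (a +i* b)%C =
    (((expR a - 1 - a) * cos b + (1 + a) * (cos b - 1)) +i*
     ((expR a - 1) * sin b + (sin b - b)))%C.
  by apply/eqP; rewrite eq_complex; apply/andP; split; apply/eqP => /=; ring.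
rewrite eq; apply: (le_trans (normc_le_Re_Im _ _)).
have cb : `|cos b| <= 1 by rewrite ler_norml cos_geN1 cos_le1.
have sb : `|sin b| <= 1 by rewrite ler_norml sin_geN1 sin_le1.
have a2 : `|1 + a| <= 2 by rewrite (le_trans (ler_normD _ _))// normr1; lra.
have t1 : `|(expR a - 1 - a) * cos b| <= e / 8 * `|a|.
  by rewrite normrM -[leRHS]mulr1 ler_pM.
have t2 : `|(1 + a) * (cos b - 1)| <= 2 * (e / 8 * `|b|).
  by rewrite normrM ler_pM.
have t3 : `|(expR a - 1) * sin b| <= e / 8 * `|a| + `|a| * (`|b| + e / 8 * `|b|).
  have -> : (expR a - 1) * sin b = (expR a - 1 - a) * sin b + a * sin b by ring.
  apply: (le_trans (ler_normD _ _)); apply: lerD.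
    by rewrite normrM -[leRHS]mulr1 ler_pM.
  rewrite normrM ler_wpM2l//.
  have -> : sin b = b + (sin b - b) by ring.
  by apply: (le_trans (ler_normD _ _)); rewrite lerD2l.
have ab : `|a| * (`|b| + e / 8 * `|b|) <= e / 8 * `|b| + e / 8 * `|b|.
  rewrite mulrDr; apply: lerD; first by rewrite ler_wpM2r// ltW.
  rewrite -[leRHS]mul1r; apply: ler_wpM2r; last exact: ltW.
  by apply: mulr_ge0 => //; exact: ltW.
apply: le_trans (lerD (ler_normD _ _) (ler_normD _ _)) _.
have := normr_ge0 a; have := normr_ge0 b.
nra.
Qed.

(** Chain rule: to first order the increment of [f (cpol u t)] is [c = L * E] times [a + i b]. Its
    real part has coefficients [Re c], [- Im c] and minus its imaginary part has [- Im c], [- Re c];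
    the trace of this matrix is 0. *)
Lemma polar_divfree (f : C -> C) u0 t0 : cdiff f (cpol u0 t0) ->
  divfree (fun u t => complex.Re (f (cpol u t)))
          (fun u t => - complex.Im (f (cpol u t))) u0 t0.
Proof.
move=> [L Lf]; set E := cpol u0 t0 in Lf; set c := L * E.
pose k := N E; have k0 : 0 < k by rewrite /k normc_cpol expR_gt0.
have L1 : 0 < N L + 1 by rewrite ltr_wpDl// normc_ge0.
exists (complex.Re c), (- complex.Im c), (- complex.Im c) => e e0.
(* One half of [e] goes to the remainder of [f], as [|cpol u t - E|] is at most [2 * k * s]; the
   other half goes to the remainder of the exponential, which is multiplied by [|c| = N L * k].
   Using [N L + 1] avoids a division by 0. *)
have e10 : 0 < e / (4 * k) by rewrite divr_gt0// mulr_gt0.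
have [d1 d10 fd] := Lf _ e10.
have e20 : 0 < e / (2 * (N L + 1) * k) by rewrite divr_gt0// !mulr_gt0.
have [d2 d20 Ed2] := cpol_dist0 e20.
have [d3 d30 Ed3] := cpol_dist0 ltr01.
exists (Num.min (Num.min d2 d3) (d1 / (8 * k))).
  by rewrite !lt_min d20 d30 divr_gt0// mulr_gt0.
move=> u t; rewrite !lt_min => /andP[/andP[ud2 ud3] ud1] /andP[/andP[td2 td3] td1].
set a := u - u0 in ud1 ud2 ud3 *; set b := t - t0 in td1 td2 td3 *.
have Eab : cpol u t = E * cpol a b by rewrite -cpolD /a /b !(addrC _ (_ - _)) !subrK.
set s := `|a| + `|b|.
have s0 : 0 <= s by rewrite addr_ge0.
have dE : N (cpol u t - E) <= 2 * k * s.
  have -> : cpol u t - E = E * ((cpol a b - 1 - (a +i* b)%C) + (a +i* b)%C).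
    by rewrite subrK mulrBr mulr1 Eab.
  rewrite Normc.normcM -/k (_ : 2 * k * s = k * (2 * s)); last by ring.
  apply: ler_wpM2l; first exact: ltW.
  apply: (le_trans (le_normcD _ _)); rewrite mulr2n mulrDl mul1r.
  apply: lerD; last exact: normc_le_Re_Im.
  by have := Ed3 _ _ ud3 td3; rewrite mul1r.
have main : N (f (cpol u t) - f E - c * (a +i* b)%C) <= e * s.
  have -> : f (cpol u t) - f E - c * (a +i* b)%C =
     (f (cpol u t) - f E - L * (cpol u t - E)) +
     c * (cpol a b - 1 - (a +i* b)%C).
    by rewrite /c Eab; ring.
  apply: (le_trans (le_normcD _ _)).
  rewrite (_ : e * s = e / (4 * k) * (2 * k * s) + e / 2 * s); last first.
    by field; rewrite gt_eqF.
  apply: lerD.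
    apply: le_trans (fd (cpol u t) _) _.
      apply: (le_lt_trans dE).
      have : s < 2 * (d1 / (8 * k)) by rewrite /s; lra.
      rewrite -(ltr_pM2l (mulr_gt0 (ltr0n _ 2) k0)) => /lt_trans; apply.
      rewrite (_ : _ * _ * _ = d1 / 2); first by lra.
      by field; rewrite gt_eqF.
    by rewrite ler_wpM2l// ltW.
  rewrite !Normc.normcM -/k.
  apply: (@le_trans _ _ ((N L + 1) * k * (e / (2 * (N L + 1) * k) * s))).
    apply: ler_pM => //; rewrite ?mulr_ge0 ?normc_ge0 ?(ltW k0)//.
      by rewrite ler_wpM2r ?(ltW k0)// lerDl.
    exact: Ed2.
  rewrite le_eqVlt; apply/orP; left; apply/eqP; field.
  by rewrite !gt_eqF.
have [mR mI] := normc_ge_Re_Im (f (cpol u t) - f E - c * (a +i* b)%C).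
move: (le_trans mR main) (le_trans mI main).
move: {main mR mI} c => c; case: (f (cpol u t)) (f E) c => [f1 f2] [g1 g2] [c1 c2] /= h1 h2; split.
  apply: le_trans h1; rewrite le_eqVlt; apply/orP; left; apply/eqP.
  by congr `|_|; ring.
apply: le_trans h2; rewrite -normrN le_eqVlt; apply/orP; left; apply/eqP.
by congr `|_|; ring.
Qed.

End polar.

(** * Averaging over a family of measure-preserving maps *)

Lemma leb4_sigma_finite (R : realType) : sigma_finite setT (@leb4 R).
Proof.
have /sigma_finiteP[F [TF ndF Foo]] := sigma_finiteT (@leb2 R).
exists (fun n => F n `*` F n).
  rewrite -setXTT TF predeqE => -[x y]; split.
    move=> [/= [n _ Fnx] [k _ Fky]]; exists (maxn n k) => //; split.
    - by move: x Fnx; exact/subsetPset/ndF/leq_maxl.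
    - by move: y Fky; exact/subsetPset/ndF/leq_maxr.
  by move=> [n _ []/= ? ?]; split; exists n.
move=> k; have [mFk Fkoo] := Foo k; split; first exact: measurableX.
by rewrite /leb4 product_measure1E// lte_mul_pinfty// ge0_fin_numE.
Qed.

HB.instance Definition _ (R : realType) :=
  Measure_isSigmaFinite.Build _ _ _ (@leb4 R) (@leb4_sigma_finite R).

Section averaging.
Local Open Scope ereal_scope.
Context (R : realType).

Lemma dilates_integrable d (X : measurableType d)
    (mu : {measure set X -> \bar R}) (T : X -> X) (F : X -> R) :
  dilates mu 1 T -> mu.-integrable setT (EFin \o F) ->
  mu.-integrable setT (EFin \o (F \o T)) /\
  \int[mu]_x (F (T x))%:E = \int[mu]_x (F x)%:E.
Proof.
move=> [mT iT] iF; have /integrableP[mF Foo] := iF.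
have mFT : measurable_fun setT (EFin \o (F \o T)).
  exact: (measurableT_comp mF mT).
split.
  apply/integrableP; split => //=.
  rewrite (iT (fun x => `|(F x)%:E|)) ?mul1e//.
  exact: measurableT_comp.
have ip := iT _ (measurable_funepos mF) (fun x => funepos_ge0 _ x).
have im := iT _ (measurable_funeneg mF) (fun x => funeneg_ge0 _ x).
rewrite integralE [in RHS]integralE; congr (_ - _).
  rewrite -[RHS]mul1e -[RHS]ip; apply: eq_integral => x _.
  by rewrite !funeposE.
rewrite -[RHS]mul1e -[RHS]im; apply: eq_integral => x _.
by rewrite !funenegE.
Qed.

(** Fubini: with [y] frozen, invariance makes the integral over [x] equal to that of [F], whatever
    [y] is. Joint integrability is the same computation for the absolute value. [B] is not
    normalized to mass 1, hence the factor [nu B]. *)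
Lemma integral_average d1 d2 (X : measurableType d1) (Y : measurableType d2)
    (mu : {sigma_finite_measure set X -> \bar R})
    (nu : {sigma_finite_measure set Y -> \bar R})
    (act : X * Y -> X) (B : set Y) (F : X -> R) :
  measurable_fun setT act -> (forall y, dilates mu 1 (fun x => act (x, y))) ->
  measurable B -> nu B < +oo -> mu.-integrable setT (EFin \o F) ->
  \int[mu]_x \int[nu]_y (F (act (x, y)) * \1_B y)%:E =
  nu B * \int[mu]_x (F x)%:E.
Proof.
move=> mact dact mB Boo iF; have /integrableP[mF Foo] := iF.
have mF' : measurable_fun setT F by apply/measurable_EFinP.
pose G (z : X * Y) := (F (act z) * \1_B z.2)%:E.
have mG : measurable_fun setT G.
  apply/measurable_EFinP; apply: measurable_funM; exact: measurableT_comp.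
have ind0 y : (0 <= \1_B y :> R)%R by rewrite indicE.
have nuB : nu B \is a fin_num by rewrite ge0_fin_numE.
have iG : (mu \x nu).-integrable setT G.
  apply/(integrable21ltyP _ _ mG).
  rewrite (_ : \int[nu]_y _ =
      \int[nu]_y ((fine (\int[mu]_x `|(F x)%:E|) * \1_B y)%:E)).
    have M0 : (0 <= fine (\int[mu]_x `|(F x)%:E|))%R.
      by rewrite fine_ge0// integral_ge0.
    rewrite (integralZl_indic _ (fun=> B))//; last by rewrite ltNge M0.
    by rewrite integral_indic// setIT lte_mul_pinfty// lee_fin.
  apply: eq_integral => y _.
  rewrite EFinM fineK ?ge0_fin_numE ?integral_ge0//.
  transitivity (\int[mu]_x ((\1_B y)%:E * `|(F (act (x, y)))%:E|)).
    by apply: eq_integral => x _; rewrite /G/= normrM (ger0_norm (ind0 _)) mulrC.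
  have /integrableP[mFy _] := (dilates_integrable (dact y) iF).1.
  rewrite ge0_integralZl//; last exact: measurableT_comp mFy.
  rewrite muleC; congr (_ * _).
  by rewrite -[RHS]mul1e -((dact y).2 (fun x => `|(F x)%:E|))//; exact: measurableT_comp.
have := Fubini iG; rewrite /fubini_F/fubini_G /G /= => ->.
rewrite (_ : \int[nu]_y _ =
    \int[nu]_y ((fine (\int[mu]_x (F x)%:E) * \1_B y)%:E)); last first.
  apply: eq_integral => y _.
  rewrite EFinM fineK; last exact: (integrable_fin_num measurableT iF).
  rewrite -(dilates_integrable (dact y) iF).2 muleC.
  rewrite -integralZl//; last exact: (dilates_integrable (dact y) iF).1.
  by apply: eq_integral => x _; rewrite -EFinM mulrC.
under eq_integral do rewrite EFinM.
rewrite integralZl//.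
  rewrite integral_indic// setIT muleC fineK//.
  exact: (integrable_fin_num measurableT iF).
apply/integrableP; split; first exact/measurable_EFinP/measurable_indic.
under eq_integral do rewrite gee0_abs ?lee_fin//.
by rewrite integral_indic// setIT.
Qed.

End averaging.

(** * The Hartogs domain and the torus action *)

Section hartogs.
Context (R : realType).
Local Notation C := (CC R).
Local Notation N := (@Normc.normc R).
Local Notation mR2 := (measurableTypeR R * measurableTypeR R)%type.

Lemma cpolP (z : C) : 0 < N z ->
  exists2 t, 0 <= t <= 2 * pi & z = cpol (ln (N z)) t.
Proof.
case: z => a b; set r := N _ => r0.
have r2 : r ^+ 2 = a ^+ 2 + b ^+ 2 by rewrite sqr_sqrtr// addr_ge0// sqr_ge0.
have rE : expR (ln r) = r by rewrite lnK// posrE.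
pose c := a / r; have aE : a = r * c by rewrite /c mulrC divfK// gt_eqF.
have bE : b ^+ 2 = (1 - c ^+ 2) * r ^+ 2.
  by rewrite /c; have -> : b ^+ 2 = r ^+ 2 - a ^+ 2 by [rewrite r2; ring]; field; rewrite gt_eqF.
have c1 : -1 <= c <= 1.
  rewrite -ler_norml -ler_sqr ?nnegrE// real_normK ?num_real// expr1n -subr_ge0.
  by rewrite -(pmulr_lge0 _ (exprn_gt0 2 r0)) -bE sqr_ge0.
have cosE : cos (acos c) = c by rewrite acosK// in_itv.
have sinE : r * sin (acos c) = `|b|.
  rewrite sin_acos// -(ger0_norm (ltW r0)) -(sqrtr_sqr r) mulrC -sqrtrM; last first.
    by rewrite -(pmulr_lge0 _ (exprn_gt0 2 r0)) -bE sqr_ge0.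
  by rewrite -bE sqrtr_sqr.
have acos0 := acos_ge0 c1; have acospi := acos_lepi c1.
have pi0 := pi_ge0 R.
case: (leP 0 b) => b0.
  exists (acos c); first by apply/andP; split; lra.
  by rewrite /cpol rE cosE sinE ger0_norm// -aE.
exists (2 * pi - acos c); first by apply/andP; split; lra.
rewrite /cpol rE (_ : 2 * pi - acos c = - acos c + pi *+ 2); last by ring.
by rewrite cosD2pi sinD2pi cosN sinN mulrN sinE cosE ltr0_norm// opprK -aE.
Qed.

Variable al : R.

(** The condition [|z1| < |z2|^al] is taken in logarithmic form: in the coordinates of [cpol] the
    domain becomes the wedge [u1 < al * u2], [u2 < 0], which is convex, with free arguments. *)
Definition hartogs : set (C2 R) :=
  [set z | [/\ 0 < N z.1, 0 < N z.2, ln (N z.1) < al * ln (N z.2) &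
    ln (N z.2) < 0]].

Lemma hartogs_cpol u1 t1 u2 t2 :
  hartogs (cpol u1 t1, cpol u2 t2) <-> u1 < al * u2 /\ u2 < 0.
Proof.
rewrite -[hartogs _]/[/\ 0 < N (cpol u1 t1), 0 < N (cpol u2 t2),
  ln (N (cpol u1 t1)) < al * ln (N (cpol u2 t2)) & ln (N (cpol u2 t2)) < 0].
rewrite !normc_cpol !expRK !expR_gt0.
by split => [[]|[]].
Qed.

Lemma hartogsP z : hartogs z -> exists u1 t1 u2 t2,
  z = (cpol u1 t1, cpol u2 t2) /\ u1 < al * u2 /\ u2 < 0.
Proof.
case: z => z1 z2 Oz; have [/= n1 n2 _ _] := Oz.
have [t1 _ e1] := cpolP n1; have [t2 _ e2] := cpolP n2.
move: Oz; rewrite e1 e2 => /hartogs_cpol Oz.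
by exists (ln (N z1)), t1, (ln (N z2)), t2.
Qed.

Definition ptR2 (u t : R) : mR2 := (expR u * cos t, expR u * sin t).

(** Point and angles form one argument, so that joint measurability can be stated, as Fubini
    requires. *)
Definition torus (y : R4 R * mR2) : R4 R :=
  (rot2 (cos y.2.1) (sin y.2.1) y.1.1, rot2 (cos y.2.2) (sin y.2.2) y.1.2).

Lemma torus_polar u1 t1 u2 t2 s1 s2 :
  torus ((ptR2 u1 t1, ptR2 u2 t2), (s1, s2)) =
  (ptR2 u1 (t1 + s1), ptR2 u2 (t2 + s2)).
Proof.
by rewrite /torus /rot2 /ptR2 /= !cosD !sinD; congr ((_, _), (_, _)); ring.
Qed.

Lemma normc_torus x s :
  N (toC2 (torus (x, s))).1 = N (toC2 x).1 /\
  N (toC2 (torus (x, s))).2 = N (toC2 x).2.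
Proof.
have rot a (b c : R) : (Num.sqrt ((cos a * b - sin a * c) ^+ 2 +
    (sin a * b + cos a * c) ^+ 2) = Num.sqrt (b ^+ 2 + c ^+ 2)).
  congr Num.sqrt; rewrite -[RHS]mul1r -(cos2Dsin2 a); ring.
by split; rewrite /= rot.
Qed.

Lemma real_coords_hartogsE y : real_coords hartogs y =
  [/\ 0 < N (toC2 y).1, 0 < N (toC2 y).2,
    ln (N (toC2 y).1) < al * ln (N (toC2 y).2) & ln (N (toC2 y).2) < 0] :> Prop.
Proof. by []. Qed.

Lemma hartogs_torus x s :
  real_coords hartogs (torus (x, s)) <-> real_coords hartogs x.
Proof.
by rewrite !real_coords_hartogsE (normc_torus x s).1 (normc_torus x s).2.
Qed.

Lemma measurable_torus : measurable_fun setT torus.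
Proof.
have mcos : measurable_fun setT (cos : measurableTypeR R -> measurableTypeR R).
  by apply: continuous_measurable_fun; exact: continuous_cos.
have msin : measurable_fun setT (sin : measurableTypeR R -> measurableTypeR R).
  by apply: continuous_measurable_fun; exact: continuous_sin.
have mrot (p : R4 R * mR2 -> mR2) (q : R4 R * mR2 -> R) :
    measurable_fun setT p -> measurable_fun setT q ->
    measurable_fun setT (fun y => rot2 (cos (q y)) (sin (q y)) (p y)).
  move=> mp mq.
  have mp1 : measurable_fun setT (fun y => (p y).1) by exact: measurableT_comp.
  have mp2 : measurable_fun setT (fun y => (p y).2) by exact: measurableT_comp.
  have mc : measurable_fun setT (fun y => cos (q y)) by exact: measurableT_comp mcos mq.
  have ms : measurable_fun setT (fun y => sin (q y)) by exact: measurableT_comp msin mq.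
  rewrite /rot2; apply: measurable_fun_pair.
    by apply: measurable_funB; apply: measurable_funM.
  by apply: measurable_funD; apply: measurable_funM.
apply: measurable_fun_pair; apply: mrot.
- exact: measurableT_comp measurable_fst measurable_fst.
- exact: measurableT_comp measurable_fst measurable_snd.
- exact: measurableT_comp measurable_snd measurable_fst.
- exact: measurableT_comp measurable_snd measurable_snd.
Qed.

Lemma torus_dilates s : dilates (@leb4 R) 1 (fun x => torus (x, s)).
Proof.
have := leb4_prod ler01 ler01 (leb2_rot (cos2Dsin2 s.1)) (leb2_rot (cos2Dsin2 s.2)).
by rewrite mulr1.
Qed.

Lemma measurable_pos d (X : measurableType d) (f : X -> R) :
  measurable_fun setT f -> measurable [set x | 0 < f x].
Proof.
move=> mf; have := mf measurableT _ (measurable_itv `]0, +oo[).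
by rewrite setTI; congr measurable; apply/seteqP; split => x /=;
  rewrite in_itv/= andbT.
Qed.

Lemma measurable_normc :
  measurable_fun setT (fun x => N (@toC2 R x).1) /\
  measurable_fun setT (fun x => N (@toC2 R x).2).
Proof.
have ms : measurable_fun setT (Num.sqrt : measurableTypeR R -> measurableTypeR R).
  by apply: continuous_measurable_fun; exact: sqrt_continuous.
have mn (p : R4 R -> mR2) : measurable_fun setT p ->
    measurable_fun setT (fun x => Num.sqrt ((p x).1 ^+ 2 + (p x).2 ^+ 2)).
  move=> mp; apply: (measurableT_comp ms).
  have mp1 : measurable_fun setT (fun y => (p y).1) by exact: measurableT_comp.
  have mp2 : measurable_fun setT (fun y => (p y).2) by exact: measurableT_comp.
  by apply: measurable_funD; exact: measurable_funX.
by split; apply: mn.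
Qed.

Lemma measurable_hartogs : measurable (real_coords hartogs).
Proof.
have [m1 m2] := measurable_normc.
have ml1 := measurableT_comp (@measurable_ln R) m1.
have ml2 := measurableT_comp (@measurable_ln R) m2.
have -> : real_coords hartogs = [set x | 0 < N (toC2 x).1] `&`
    [set x | 0 < N (toC2 x).2] `&`
    [set x | 0 < al * ln (N (toC2 x).2) - ln (N (toC2 x).1)] `&`
    [set x | 0 < - ln (N (toC2 x).2)].
  apply/seteqP; split => x.
    by rewrite real_coords_hartogsE => -[h1 h2 h3 h4]; do !split => //=;
      rewrite ?subr_gt0 ?oppr_gt0.
  rewrite real_coords_hartogsE => -[[[h1 h2] h3] h4]; split => //.
    by rewrite -subr_gt0.
  by rewrite -oppr_gt0.
apply: measurableI; [apply: measurableI; [apply: measurableI|]|];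
  apply: measurable_pos => //.
  by apply: measurable_funB => //; exact: measurable_funM.
exact: measurableT_comp.
Qed.

End hartogs.

(** * Continuity of the polar parametrization *)

Section complex_topology.
Context (R : realType).
Local Notation C := (CC R).
Local Notation N := (@Normc.normc R).

Lemma cvg_complex (T : Type) (F : set_system T) (FF : Filter F) (f g : T -> R)
    (a b : R) : f @ F --> a -> g @ F --> b ->
  (fun x => (f x +i* g x)%C : C) @ F --> ((a +i* b)%C : C).
Proof.
move=> fa gb; apply/cvgrPdist_lt => e /posCP[d d0 ->].
have d2 : 0 < d / 2 by rewrite divr_gt0.
near=> x; rewrite normCE ltCR.
apply: (@le_lt_trans _ _ (`|a - f x| + `|b - g x|)); first exact: normc_le_Re_Im.
rewrite [ltRHS]splitr ltrD//.
  by near: x; move/cvgrPdist_lt : fa; exact.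
by near: x; move/cvgrPdist_lt : gb; exact.
Unshelve. all: end_near. Qed.

Lemma continuous_Re : continuous (fun z : C => complex.Re z : R).
Proof.
move=> z; have FF := @nbhs_filter C z.
apply/(cvgrPdist_lt (F := nbhs z)) => e e0.
have e0' : 0 < (e%:C)%C :> C by rewrite ltCR.
apply/nbhs_normP; exists (e%:C)%C => // w zw.
have {}zw : N (z - w) < e by rewrite -ltCR -normCE.
apply: le_lt_trans zw; have [+ _] := normc_ge_Re_Im (z - w).
by clear FF; case: z w => [a b] [c d].
Qed.

Definition polmap (y : (R * R) * (R * R)) : C2 R :=
  (cpol y.1.1 y.1.2, cpol y.2.1 y.2.2).

Lemma continuous_polmap : continuous polmap.
Proof.
have c (p q : (R * R) * (R * R) -> R) y : {for y, continuous p} ->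
    {for y, continuous q} -> (fun y => cpol (p y) (q y)) @ y --> cpol (p y) (q y).
  move=> cp cq; have ce : (expR \o p) @ y --> expR (p y).
    by apply: continuous_comp => //; exact: continuous_expR.
  have cc : (cos \o q) @ y --> cos (q y).
    by apply: continuous_comp => //; exact: continuous_cos.
  have cs : (sin \o q) @ y --> sin (q y).
    by apply: continuous_comp => //; exact: continuous_sin.
  by apply: cvg_complex; exact: cvgM.
have c11 : continuous (fun y : (R * R) * (R * R) => y.1.1).
  by move=> y; apply: continuous_comp; exact: cvg_fst.
have c12 : continuous (fun y : (R * R) * (R * R) => y.1.2).
  by move=> y; apply: continuous_comp; [exact: cvg_fst|exact: cvg_snd].
have c21 : continuous (fun y : (R * R) * (R * R) => y.2.1).
  by move=> y; apply: continuous_comp; [exact: cvg_snd|exact: cvg_fst].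
have c22 : continuous (fun y : (R * R) * (R * R) => y.2.2).
  by move=> y; apply: continuous_comp; exact: cvg_snd.
move=> y; have FF := @nbhs_filter _ y.
have /cvgrPdist_lt cp1 := c _ _ y (c11 y) (c12 y).
have /cvgrPdist_lt cp2 := c _ _ y (c21 y) (c22 y).
apply/(cvgrPdist_lt (F := nbhs y)) => e e0; near=> x.
rewrite prod_normE /Order.max; case: ifP => _.
  by near: x; exact: cp2.
by near: x; exact: cp1.
Unshelve. all: end_near. Qed.

End complex_topology.

(** * Means over circles do not depend on the radius *)

Section circle_mean.
Context (R : realType).
Local Notation C := (CC R).
Local Notation N := (@Normc.normc R).

(** Extended by 0 outside the segment, [f] becomes an integrable function on the line, where
    translation invariance applies. *)
Lemma segint_translate (f : R -> R) (s a b : R) : ctn f (a + s) (b + s) ->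
  segint (fun t => f (t + s)) a b = segint f (a + s) (b + s).
Proof.
move=> cf; rewrite /segint [LHS]Rintegral_mkcond [RHS]Rintegral_mkcond; congr fine.
have iF : (@lebesgue_measure R).-integrable setT
    (EFin \o (f \_ `[a + s, b + s])).
  by rewrite -restrict_EFin; apply/integrable_restrict => //=; rewrite setTI; exact: ctn_integrable.
rewrite -(dilates_integrable (lebesgue_translation s) iF).2.
apply: eq_integral => x _; congr EFin; rewrite !patchE.
have -> // : (x + s \in `[a + s, b + s]%classic) = (x \in `[a, b]%classic).
by apply/idP/idP; rewrite !inE/= !in_itv/= !lerD2r.
Qed.

(** [s] is reduced modulo the period to some [r] between 0 and [2 * pi]; there the segment is cut at
    [2 * pi] and the overhang moved back by one period. *)
Lemma segint_period (f : R -> R) s : (forall t, f (t + 2 * pi) = f t) ->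
  continuous f -> segint f s (s + 2 * pi) = segint f 0 (2 * pi).
Proof.
have pi0 := pi_gt0 R.
move=> fper cf; have cfab a b : ctn f a b by move=> x _; exact: cf.
have sh a b : segint f (a + 2 * pi) (b + 2 * pi) = segint f a b.
  by rewrite -segint_translate//; congr segint; apply/funext => t; rewrite fper.
have per1 r : 0 <= r <= 2 * pi -> segint f r (r + 2 * pi) = segint f 0 (2 * pi).
  move=> /andP[r0 r1].
  rewrite (@segint_split _ f r (2 * pi) (r + 2 * pi))//; last by lra.
  rewrite -[X in segint f X (r + _)]add0r sh addrC.
  by rewrite [RHS](@segint_split _ f 0 r (2 * pi)).
suff nat_shift n r : segint f (r + n%:R * (2 * pi)) (r + n%:R * (2 * pi) + 2 * pi) =
    segint f r (r + 2 * pi).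
  have [m [r [rP mE]]] : exists m : int, exists r, 0 <= r <= 2 * pi /\
      s = r + m%:~R * (2 * pi).
    exists (Num.floor (s / (2 * pi))), (s - (Num.floor (s / (2 * pi)))%:~R * (2 * pi)).
    split; last by rewrite subrK.
    have p0 : 0 < 2 * pi :> R by rewrite mulr_gt0.
    have /andP[h1 h2] := floor_itv (s / (2 * pi)).
    rewrite ler_pdivlMr// in h1; rewrite ltr_pdivrMr// intrD mulrDl mul1r in h2.
    by apply/andP; split; lra.
  case: m mE => n mE.
    by rewrite mE nat_shift per1.
  (* For a negative multiple the shift is applied to [s] itself: [n.+1] periods up, it lands on
     [r]. *)
  rewrite -[LHS](nat_shift n.+1 s) mE -addrA -mulrDl NegzE mulrNz.
  by rewrite addNr mul0r addr0 per1.
elim: n => [|n IH]; first by rewrite mul0r addr0.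
rewrite -IH -[RHS]sh -natr1 mulrDl mul1r.
by rewrite !addrA.
Qed.

(* Goursat's theorem on a rectangle in logarithmic polar coordinates: the two
   sides of constant argument cancel by periodicity. *)
Lemma circle_mean (f : C -> C) a b s t : a <= b ->
  (forall u r, a <= u <= b -> cdiff f (cpol u r)) ->
  segint (fun x => complex.Re (f (cpol a (s + x)))) 0 (2 * pi) =
  segint (fun x => complex.Re (f (cpol b (t + x)))) 0 (2 * pi).
Proof.
move=> ab df; have pi0 := pi_gt0 R.
pose A u r := complex.Re (f (cpol u r)).
have D c d : divfree_on A (fun u r => - complex.Im (f (cpol u r))) a b c d.
  by move=> u r /df fur _; exact: polar_divfree.
have cA u : a <= u <= b -> continuous (A u).
  move=> uab r; have rr : r <= r <= r by rewrite lexx.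
  by have [+ _] := divfree_on_ctn2 (D r r) uab; exact.
have per u r : cpol u (r + 2 * pi) = cpol u r :> C.
  by rewrite /cpol mulr_natl cosD2pi sinD2pi.
have shift u r : a <= u <= b ->
    segint (fun x => A u (r + x)) 0 (2 * pi) = segint (A u) 0 (2 * pi).
  move=> uab; rewrite -(@segint_period (A u) r); last 2 first.
  - by move=> x; rewrite /A per.
  - exact: cA.
  rewrite (_ : (fun x => A u (r + x)) = (fun x => A u (x + r))); last first.
    by apply/funext => x; rewrite addrC.
  rewrite segint_translate ?add0r 1?addrC//.
  by move=> x _; exact: cA.
have haa : a <= a <= b by rewrite lexx ab.
have hbb : a <= b <= b by rewrite ab lexx.
apply: etrans (shift a s haa) (etrans _ (esym (shift b t hbb))).
have := flux_eq0 ab (_ : 0 <= 2 * pi) (D 0 (2 * pi)).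
have -> : 0 <= 2 * pi :> R by rewrite mulr_ge0// ltW.
move=> /(_ isT); rewrite /flux.
rewrite (_ : (fun u => - complex.Im (f (cpol u (2 * pi)))) =
   (fun u => - complex.Im (f (cpol u 0)))); last first.
  by apply/funext => u; rewrite -[in LHS](add0r (2 * pi)) per.
by rewrite subrr addr0 => /subr0_eq/esym.
Qed.

End circle_mean.

(** * Means over the tori of the domain are all equal *)

Section torus_mean.
Context (R : realType) (al : R).
Local Notation C := (CC R).
Local Notation N := (@Normc.normc R).
Local Notation mR2 := (measurableTypeR R * measurableTypeR R)%type.
Local Notation period := (`[0%R, (2 * pi)%R]%classic : set (measurableTypeR R)).
Local Notation square := (period `*` period : set mR2).

Lemma integral_segint (f : R -> R) a b : ctn f a b ->
  (\int[lebesgue_measure]_x (f x * \1_(`[a, b]%classic : set (measurableTypeR R)) x)%:E)%E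
  = (segint f a b)%:E.
Proof.
move=> cf; rewrite /segint /Rintegral fineK; last first.
  by apply: integrable_fin_num => //; exact: ctn_integrable.
rewrite [RHS]integral_mkcond; apply: eq_integral => x _.
by rewrite patchE indicE; case: ifP => _; rewrite ?mulr1 ?mulr0.
Qed.

Lemma measurable_square : measurable square.
Proof. by apply: measurableX; exact: measurable_itv. Qed.

Lemma leb2_square : @leb2 R square = ((2 * pi) ^+ 2)%:E.
Proof.
rewrite /leb2 product_measure1E//; do ?exact: measurable_itv.
have pi0 := pi_gt0 R.
by rewrite /= lebesgue_measure_itv/= lte_fin mulr_gt0//= sube0 -EFinM.
Qed.

Variable g : C2 R -> C.
Hypothesis holg : holomorphic_on (hartogs al) g.
Hypothesis mg : measurable_fun (real_coords (hartogs al))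
  (fun x => complex.Re (g (toC2 x))).

(** [y] lists the logarithm of the modulus and the argument of each coordinate; [s] advances the two
    arguments. *)
Let k (y : (R * R) * (R * R)) (s : R * R) : R :=
  complex.Re (g (polmap ((y.1.1, y.1.2 + s.1), (y.2.1, y.2.2 + s.2)))).

Let ok (y : (R * R) * (R * R)) := y.1.1 < al * y.2.1 /\ y.2.1 < 0.

Let differentiable_g y : ok y -> differentiable g (polmap y).
Proof. by move=> oky; apply: holg; apply/hartogs_cpol. Qed.

Let continuous_k y : ok y -> continuous (k y : R * R -> R).
Proof.
move=> oky s.
have c1 : {for s, continuous (fun s : R * R => ((y.1.1, y.1.2 + s.1), (y.2.1, y.2.2 + s.2)))}.
  have c1 : (fun s : R * R => y.1.2 + s.1) @ s --> y.1.2 + s.1.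
    by apply: cvgD; [exact: cvg_cst|exact: cvg_fst].
  have c2 : (fun s : R * R => y.2.2 + s.2) @ s --> y.2.2 + s.2.
    by apply: cvgD; [exact: cvg_cst|exact: cvg_snd].
  exact: (cvg_pair (cvg_pair (cvg_cst y.1.1) c1) (cvg_pair (cvg_cst y.2.1) c2)).
have c2 := continuous_comp c1 (@continuous_polmap R _).
have c3 : {for polmap ((y.1.1, y.1.2 + s.1), (y.2.1, y.2.2 + s.2)), continuous g}.
  by apply: differentiable_continuous; exact: differentiable_g.
have c4 := continuous_comp c2 c3.
exact: (continuous_comp c4 (@continuous_Re R _)).
Qed.

Let measurable_k y : ok y -> measurable_fun setT (k y : mR2 -> R).
Proof.
move=> oky; pose T (s : mR2) := torus ((ptR2 y.1.1 y.1.2, ptR2 y.2.1 y.2.2), s).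
have -> : k y = (fun x => complex.Re (g (toC2 x))) \o T.
  by apply/funext => -[s1 s2]; rewrite /k /T /= torus_polar.
apply: (measurable_comp (F := real_coords (hartogs al))) => //.
- exact: measurable_hartogs.
- move=> _ [s _ <-]; apply/hartogs_torus.
  by apply/(hartogs_cpol al y.1.1 y.1.2 y.2.1 y.2.2).
- apply: measurableT_comp; first exact: measurable_torus.
  exact: measurable_pair1.
Qed.

Let integrable_k y : ok y ->
  (@leb2 R).-integrable setT (fun s => (k y s * \1_square s)%:E).
Proof.
move=> oky; have : (@leb2 R).-integrable square (EFin \o k y).
  apply: measurable_bounded_integrable.
  - exact: measurable_square.
  - by rewrite [ltLHS]leb2_square ltry.
  - exact: measurable_funTS (measurable_k oky).
  - have cs : compact (`[0%R, (2 * pi)%R]%classic `*` `[0%R, (2 * pi)%R]%classic : set (R * R)).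
      by apply: compact_setX; exact: segment_compact.
    have := continuous_compact (continuous_subspaceT (continuous_k oky)) cs.
    move/compact_bounded => [M [Mr MP]]; exists M; split => // x Mx s ss.
    by apply: MP => //; exists s.
move=> /(integrable_mkcond _ measurable_square).
apply: eq_integrable => // s _.
by rewrite patchE indicE; case: ifP => _; rewrite ?mulr1 ?mulr0.
Qed.

Let J y := (\int[@leb2 R]_s (k y s * \1_square s)%:E)%E.

Let indic_square (a b : R) : \1_square (a, b) = \1_period a * \1_period b :> R.
Proof. by rewrite !indicE in_setX -natrM mulnb. Qed.

(** With the second angle frozen, the integral over the first is a circle mean of a function of one
    variable. All intermediate radii are admissible, since [u <= v1 < al * u2]. *)
Let J1 u1 t1 v1 r1 u2 t2 : ok ((u1, t1), (u2, t2)) -> ok ((v1, r1), (u2, t2)) ->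
  J ((u1, t1), (u2, t2)) = J ((v1, r1), (u2, t2)).
Proof.
wlog uv : u1 t1 v1 r1 / u1 <= v1.
  move=> H oku okv; have [/H|/ltW/H h] := leP u1 v1; first exact.
  by rewrite (h r1 t1).
move=> oku okv; rewrite /J /leb2.
rewrite -(integral21_prod_meas1 (integrable_k oku)).
rewrite -(integral21_prod_meas1 (integrable_k okv)).
pose f (s2 : R) (w : C) := g (w, cpol u2 (t2 + s2)).
have df s2 u r : u1 <= u <= v1 -> cdiff (f s2) (cpol u r).
  move=> /andP[_ uv1]; apply: (differentiable_cdiff1 (z := (_, _))).
  apply: holg; apply/hartogs_cpol; split; last exact: oku.2.
  by apply: (le_lt_trans uv1); exact: okv.1.
have E (s2 : R) u t : ok ((u, t), (u2, t2)) ->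
    (\int[lebesgue_measure]_s1 (k ((u, t), (u2, t2)) (s1, s2) * \1_square (s1, s2))%:E)%E =
    (segint (fun s1 => complex.Re (f s2 (cpol u (t + s1)))) 0 (2 * pi) * \1_period s2)%:E.
  move=> oky; have cf : ctn (fun s1 => complex.Re (f s2 (cpol u (t + s1)))) 0 (2 * pi).
    move=> x _.
    have c : {for x, continuous (fun s1 => (s1, s2) : R * R)}.
      exact: (cvg_pair cvg_id (cvg_cst s2)).
    have := continuous_comp c (@continuous_k _ oky (x, s2)); exact.
  rewrite (eq_integral (fun s1 : measurableTypeR R => (complex.Re (f s2 (cpol u (t + s1))) *
    \1_period s1 * \1_period s2)%:E)); last first.
    by move=> s1 _; rewrite indic_square mulrA.
  have [s2P|s2P] := boolP (s2 \in period).
    rewrite [\1_period s2]indicE s2P mulr1 -integral_segint//.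
    by apply: eq_integral => s1 _; rewrite mulr1.
  rewrite [\1_period s2]indicE (negbTE s2P) mulr0.
  by apply: integral0_eq => s1 _; rewrite mulr0.
apply: eq_integral => s2 _; rewrite /fubini_G (E s2 _ _ oku) (E s2 _ _ okv).
by rewrite (circle_mean t1 r1 uv (df s2)).
Qed.

Let J2 u2 t2 v2 r2 u1 t1 : ok ((u1, t1), (u2, t2)) -> ok ((u1, t1), (v2, r2)) ->
  J ((u1, t1), (u2, t2)) = J ((u1, t1), (v2, r2)).
Proof.
wlog uv : u2 t2 v2 r2 / u2 <= v2.
  move=> H oku okv; have [/H|/ltW/H h] := leP u2 v2; first exact.
  by rewrite (h r2 t2).
move=> oku okv; rewrite /J /leb2.
rewrite -(integral12_prod_meas1 (integrable_k oku)).
rewrite -(integral12_prod_meas1 (integrable_k okv)).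
pose f (s1 : R) (w : C) := g (cpol u1 (t1 + s1), w).
have df s1 u r : u2 <= u <= v2 -> cdiff (f s1) (cpol u r).
  move=> /andP[uv2 uv1]; apply: (differentiable_cdiff2 (z := (_, _))).
  apply: holg; apply/hartogs_cpol; split.
    (* A segment between two points of the wedge stays in it; which end bounds [al * u] from below
       depends on the sign of [al]. *)
    have [/= h1 _] := oku; have [/= h2 _] := okv; have [al0|al0] := leP 0 al.
      by apply: (lt_le_trans h1); exact: ler_wpM2l.
    by apply: (lt_le_trans h2); rewrite ler_nM2l.
  by have [_ /= h2] := okv; exact: le_lt_trans h2.
have E (s1 : R) u t : ok ((u1, t1), (u, t)) ->
    (\int[lebesgue_measure]_s2 (k ((u1, t1), (u, t)) (s1, s2) * \1_square (s1, s2))%:E)%E =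
    (segint (fun s2 => complex.Re (f s1 (cpol u (t + s2)))) 0 (2 * pi) * \1_period s1)%:E.
  move=> oky; have cf : ctn (fun s2 => complex.Re (f s1 (cpol u (t + s2)))) 0 (2 * pi).
    move=> x _.
    have c : {for x, continuous (fun s2 => (s1, s2) : R * R)}.
      exact: (cvg_pair (cvg_cst s1) cvg_id).
    have := continuous_comp c (@continuous_k _ oky (s1, x)); exact.
  rewrite (eq_integral (fun s2 : measurableTypeR R => (complex.Re (f s1 (cpol u (t + s2))) *
    \1_period s2 * \1_period s1)%:E)); last first.
    by move=> s2 _; rewrite indic_square mulrCA mulrC.
  have [s1P|s1P] := boolP (s1 \in period).
    rewrite [\1_period s1]indicE s1P mulr1 -integral_segint//.
    by apply: eq_integral => s2 _; rewrite mulr1.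
  rewrite [\1_period s1]indicE (negbTE s1P) mulr0.
  by apply: integral0_eq => s2 _; rewrite mulr0.
apply: eq_integral => s1 _; rewrite /fubini_F (E s1 _ _ oku) (E s1 _ _ okv).
by rewrite (circle_mean t2 r2 uv (df s1)).
Qed.

Lemma torus_mean : exists K : R, forall x, real_coords (hartogs al) x ->
  (@leb2 R).-integrable setT
    (fun s => (complex.Re (g (toC2 (torus (x, s)))) * \1_square s)%:E) /\
  (\int[@leb2 R]_s (complex.Re (g (toC2 (torus (x, s)))) * \1_square s)%:E)%E = K%:E.
Proof.
pose y0 : (R * R) * (R * R) := ((- `|al| - 1, 0), (-1, 0)).
have ok0 : ok y0.
  by split; rewrite /= ?mulrN1; [have := ler_norm al|]; lra.
exists (fine (J y0)) => x Dx.
have [u1 [t1 [u2 [t2 [xE [u12 u20]]]]]] := hartogsP Dx.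
have oky : ok ((u1, t1), (u2, t2)) by [].
have -> : x = (ptR2 u1 t1, ptR2 u2 t2).
  by move: xE; case: (x) => [[a b] [c d]]; rewrite /toC2 /cpol /ptR2/= => -[-> -> -> ->].
have kE : (fun s => (complex.Re (g (toC2 (torus ((ptR2 u1 t1, ptR2 u2 t2), s)))) *
    \1_square s)%:E) = (fun s => (k ((u1, t1), (u2, t2)) s * \1_square s)%:E).
  by apply/funext => -[s1 s2]; rewrite torus_polar.
rewrite kE; split; first exact: integrable_k.
rewrite fineK; last exact: integrable_fin_num (integrable_k ok0).
(* The path to the base point: lower the first logarithm to [m], which is admissible both with [u2]
   and with -1; change the second one to -1; then move the first one to its base value. *)
pose m := Num.min u1 (- `|al| - 1).
have m1 : m <= u1 by rewrite ge_min lexx.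
have m2 : m <= - `|al| - 1 by rewrite ge_min lexx orbT.
have okm : ok ((m, 0), (u2, t2)) by split => //=; exact: le_lt_trans u12.
have okm' : ok ((m, 0), (-1, 0)).
  by split => //=; exact: le_lt_trans ok0.1.
by rewrite -[LHS]/(J ((u1, t1), (u2, t2))) (J1 oky okm) (J2 okm okm') (J1 okm' ok0).
Qed.

(* Averaging over the torus replaces [Re g] by its constant torus mean. *)
Lemma torus_invariant_integral0 (W : R4 R -> R) :
  (forall x, ~ real_coords (hartogs al) x -> W x = 0) ->
  (forall x s, W (torus (x, s)) = W x) ->
  (@leb4 R).-integrable setT (EFin \o W) ->
  (@leb4 R).-integrable setT (fun x => (W x * complex.Re (g (toC2 x)))%:E) ->
  (\int[@leb4 R]_x (W x)%:E = 0)%E ->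
  (\int[@leb4 R]_x (W x * complex.Re (g (toC2 x)))%:E = 0)%E.
Proof.
move=> W0 Winv iW iWg intW.
have [K KP] := torus_mean.
have := integral_average (@measurable_torus R) (@torus_dilates R) (@measurable_square)
  (_ : (@leb2 R square < +oo)%E) iWg.
rewrite [X in (X < +oo)%E -> _]leb2_square ltry => /(_ isT).
rewrite (_ : (\int[_]_x \int[_]_y _)%E = (\int[@leb4 R]_x (W x * K)%:E)%E); last first.
  apply: eq_integral => x _.
  have [Dx|Dx] := pselect (real_coords (hartogs al) x); last first.
    by rewrite W0// mul0r; apply: integral0_eq => s _; rewrite Winv W0// !mul0r.
  have [iK KE] := KP x Dx; rewrite EFinM -KE -integralZl//.
  by apply: eq_integral => s _; rewrite Winv -EFinM mulrA.
under eq_integral do rewrite mulrC EFinM.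
rewrite integralZl// intW mule0 => /esym/eqP.
rewrite mule_eq0 => /orP[|/eqP//].
rewrite [X in X == _]leb2_square eqe sqrf_eq0 mulf_eq0 pnatr_eq0/= => /eqP pi0.
by have := pi_gt0 R; rewrite pi0 ltxx.
Qed.

End torus_mean.

(** * Norms as integrals, and the projection at exponent 2 *)

Section LpNorm.
Context (R : realType) (Omega : set (C2 R)).
Local Notation C := (CC R).
Local Notation N := (@Normc.normc R).
Local Notation D := (real_coords Omega).
Local Notation mu := (@leb4 R).
Hypothesis mD : measurable D.
Implicit Types f g h : C2 R -> C.

Definition Lpint (p : R) f : \bar R :=
  (\int[mu]_(x in D) (N (f (toC2 x)) `^ p)%:E)%E.

Lemma Lpint_ge0 p f : (0 <= Lpint p f)%E.
Proof. by apply: integral_ge0 => x _; rewrite lee_fin powR_ge0. Qed.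

Lemma LpNormE p f : 0 < p -> LpNorm Omega p f = (Lpint p f `^ p^-1)%E.
Proof.
move=> p0; rewrite /LpNorm unlock; apply: (f_equal (fun u => poweR u p^-1)).
rewrite /Lpint [RHS]integral_mkcond; apply: eq_integral => x _ /=.
rewrite !patchE; case: ifP => _ /=; last by rewrite normr0 powR0// gt_eqF.
by rewrite ger0_norm// normc_ge0.
Qed.

Lemma LpNorm_lty p f : 0 < p -> (LpNorm Omega p f < +oo)%E = (Lpint p f < +oo)%E.
Proof.
move=> p0; rewrite LpNormE//; apply/idP/idP; last exact: poweR_lty.
by apply: lty_poweRy; rewrite invr_neq0// gt_eqF.
Qed.

Lemma sqr_normc_Re_Im (z : C) : N z ^+ 2 = complex.Re z ^+ 2 + complex.Im z ^+ 2.
Proof. by case: z => a b; rewrite /= sqr_sqrtr// addr_ge0// sqr_ge0. Qed.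

Lemma Lpint2E f : Lpint 2 f = (\int[mu]_(x in D) (N (f (toC2 x)) ^+ 2)%:E)%E.
Proof. by apply: eq_integral => x _; rewrite powR_mulrn// normc_ge0. Qed.

Lemma measurable_sqr_normc f : measurable_on Omega f ->
  measurable_fun D (fun x => N (f (toC2 x)) ^+ 2).
Proof.
move=> [mR mI]; under eq_fun do rewrite sqr_normc_Re_Im.
by apply: measurable_funD; exact: measurable_funX.
Qed.

Lemma measurable_normc_powR f p : measurable_on Omega f ->
  measurable_fun D (fun x => N (f (toC2 x)) `^ p).
Proof.
move=> /measurable_sqr_normc mf.
have ms : measurable_fun setT (Num.sqrt : measurableTypeR R -> measurableTypeR R).
  by apply: continuous_measurable_fun; exact: sqrt_continuous.
apply: (measurableT_comp (@measurable_powR R p)).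
have := measurableT_comp ms mf; congr measurable_fun; apply/funext => x /=.
by rewrite sqrtr_sqr ger0_norm// normc_ge0.
Qed.

Lemma Lp2_integrable f : Lp Omega 2 f ->
  mu.-integrable D (fun x => (N (f (toC2 x)) ^+ 2)%:E).
Proof.
move=> [mf]; rewrite LpNorm_lty// Lpint2E => foo; apply/integrableP; split.
  by apply/measurable_EFinP; exact: measurable_sqr_normc.
by under eq_integral do rewrite gee0_abs ?lee_fin ?sqr_ge0//.
Qed.

(** The common source of integrability for the quadratic expressions in two square-integrable
    functions: differences, pairings and weighted squares. *)
Lemma Lp2_dominated f g (u : R4 R -> R) (k : R) : Lp Omega 2 f -> Lp Omega 2 g ->
  measurable_fun D u ->
  (forall x, D x -> `|u x| <= k * (N (f (toC2 x)) ^+ 2 + N (g (toC2 x)) ^+ 2)) ->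
  mu.-integrable D (EFin \o u).
Proof.
move=> Lf Lg mfu ule.
have i := integrableZl mD k (integrableD mD (Lp2_integrable Lf) (Lp2_integrable Lg)).
apply: (le_integrable mD _ _ i).
  exact/measurable_EFinP.
move=> x Dx /=; rewrite lee_fin; apply: (le_trans (ule x Dx)).
exact: ler_norm.
Qed.

Lemma Re_mul_conjc (z w : C) : complex.Re (z * (w^*)%C) =
  complex.Re z * complex.Re w + complex.Im z * complex.Im w.
Proof. by case: z w => [a b] [c d] /=; ring. Qed.

Lemma ReB (z w : C) : complex.Re (z - w) = complex.Re z - complex.Re w.
Proof. by case: z w => [a b] [c d]. Qed.

Lemma ImB (z w : C) : complex.Im (z - w) = complex.Im z - complex.Im w.
Proof. by case: z w => [a b] [c d]. Qed.

Lemma measurable_onB f g : measurable_on Omega f -> measurable_on Omega g ->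
  measurable_on Omega (fun z => f z - g z).
Proof.
move=> [fR fI] [gR gI]; split.
  by under eq_fun do rewrite ReB; exact: measurable_funB.
by under eq_fun do rewrite ImB; exact: measurable_funB.
Qed.

Lemma measurable_Re_dot f g : measurable_on Omega f -> measurable_on Omega g ->
  measurable_fun D (fun x => complex.Re (f (toC2 x) * ((g (toC2 x))^*)%C)).
Proof.
move=> [fR fI] [gR gI]; under eq_fun do rewrite Re_mul_conjc.
by apply: measurable_funD; exact: measurable_funM.
Qed.

Lemma normc_sqr_le (z w : C) : N (z - w) ^+ 2 <= 2 * (N z ^+ 2 + N w ^+ 2).
Proof.
rewrite !sqr_normc_Re_Im; case: z w => [a b] [c d] /=.
have := sqr_ge0 (a + c); have := sqr_ge0 (b + d); nra.
Qed.

Lemma Lp2B f g : Lp Omega 2 f -> Lp Omega 2 g -> Lp Omega 2 (fun z => f z - g z).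
Proof.
move=> Lf Lg; have mfg := measurable_onB Lf.1 Lg.1; split=> //.
rewrite LpNorm_lty// Lpint2E.
have : mu.-integrable D (EFin \o (fun x => N (f (toC2 x) - g (toC2 x)) ^+ 2)).
  apply: (@Lp2_dominated f g _ 2) => //; first exact: measurable_sqr_normc mfg.
  by move=> x _; rewrite ger0_norm ?sqr_ge0// normc_sqr_le.
by move=> /integrableP[_]; under eq_integral do rewrite gee0_abs ?lee_fin ?sqr_ge0//.
Qed.

Lemma Re_dot_le (z w : C) : `|complex.Re (z * (w^*)%C)| <= 1 * (N z ^+ 2 + N w ^+ 2).
Proof.
rewrite Re_mul_conjc mul1r !sqr_normc_Re_Im; case: z w => [a b] [c d] /=.
have := sqr_ge0 (a + c); have := sqr_ge0 (b + d).
have := sqr_ge0 (a - c); have := sqr_ge0 (b - d).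
rewrite ler_norml => *; apply/andP; split; nra.
Qed.

Lemma integrable_Re_dot f g : Lp Omega 2 f -> Lp Omega 2 g ->
  mu.-integrable D (EFin \o (fun x => complex.Re (f (toC2 x) * ((g (toC2 x))^*)%C))).
Proof.
move=> Lf Lg; apply: (Lp2_dominated Lf Lg); last by move=> x _; exact: Re_dot_le.
by apply: measurable_Re_dot; [exact: Lf.1|exact: Lg.1].
Qed.

Lemma L2dot_Re f h : L2dot Omega f h = 0 ->
  (\int[mu]_(x in D) complex.Re (f (toC2 x) * ((h (toC2 x))^*)%C))%R = 0.
Proof. by move=> /(congr1 (@complex.Re R)). Qed.

(** Pointwise [|f|^2] is at least [|g|^2] plus twice the real part of [f - g] times the conjugate of
    [g], the difference being [|f - g|^2]. The last term integrates to 0 by orthogonality tested on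
    [g] itself. *)
Lemma bergman_contraction f g : Lp Omega 2 f -> is_bergman_projection Omega f g ->
  (Lpint 2 g <= Lpint 2 f)%E.
Proof.
move=> Lf [Hg orth]; have Lg := Hg.2.
have := L2dot_Re (orth g Hg) => I0.
have iD := integrable_Re_dot (Lp2B Lf Lg) Lg.
have ig := Lp2_integrable Lg; have if2 := Lp2_integrable Lf.
rewrite !Lpint2E -(fineK (integrable_fin_num mD ig)) -(fineK (integrable_fin_num mD if2)).
rewrite lee_fin -[leLHS]addr0 -(mulr0 2) -I0.
rewrite -RintegralZl// -RintegralD//; last exact: (integrableZl mD 2 iD).
apply: le_Rintegral => //.
  by have := integrableD mD ig (integrableZl mD 2 iD); exact.
move=> x _; rewrite Re_mul_conjc ReB ImB !sqr_normc_Re_Im.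
have := sqr_ge0 (complex.Re (f (toC2 x)) - complex.Re (g (toC2 x))).
have := sqr_ge0 (complex.Im (f (toC2 x)) - complex.Im (g (toC2 x))).
nra.
Qed.

(** The difference [d = g - g'] lies in the Bergman space, and subtracting the two orthogonality
    relations tested on [d] leaves the integral of [|d|^2]. So [d] vanishes almost everywhere and
    every norm agrees. *)
Lemma bergman_projection_unique f g g' p : 0 < p -> Lp Omega 2 f ->
  is_bergman_projection Omega f g -> is_bergman_projection Omega f g' ->
  LpNorm Omega p g = LpNorm Omega p g'.
Proof.
move=> p0 Lf [Hg og] [Hg' og']; have [Lg Lg'] := (Hg.2, Hg'.2).
pose d z := g z - g' z.
have Ld : Lp Omega 2 d by exact: Lp2B.
have Hd : bergman_space Omega d.
  split; last exact: Ld.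
  by move=> z Oz; exact: (differentiableB (Hg.1 z Oz) (Hg'.1 z Oz)).
have I1 := L2dot_Re (og d Hd); have I2 := L2dot_Re (og' d Hd).
have i1 := integrable_Re_dot (Lp2B Lf Lg) Ld.
have i2 := integrable_Re_dot (Lp2B Lf Lg') Ld.
have I0 : (\int[mu]_(x in D) N (d (toC2 x)) ^+ 2 = 0)%R.
  rewrite -[RHS](subrr 0) -{1}I2 -I1 -RintegralB//.
  apply: eq_Rintegral => x _; rewrite !Re_mul_conjc sqr_normc_Re_Im /d !ReB !ImB.
  ring.
have id := Lp2_integrable Ld.
have : (\int[mu]_(x in D) `|(N (d (toC2 x)) ^+ 2)%:E|)%E = 0%E.
  rewrite (eq_integral (fun x => (N (d (toC2 x)) ^+ 2)%:E)).
    by rewrite -(fineK (integrable_fin_num mD id)); congr EFin; exact: I0.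
  by move=> x _; rewrite gee0_abs// lee_fin sqr_ge0.
have /integrableP[md _] := id.
move/(ae_eq_integral_abs mu mD md) => ae0.
rewrite (LpNormE g p0) (LpNormE g' p0); apply: (f_equal (fun u => poweR u p^-1)).
apply: (ge0_ae_eq_integral mD).
- by apply/measurable_EFinP; apply: measurable_normc_powR; exact: Lg.1.
- by apply/measurable_EFinP; apply: measurable_normc_powR; exact: Lg'.1.
- by move=> x _; rewrite lee_fin powR_ge0.
- by move=> x _; rewrite lee_fin powR_ge0.
apply: filterS ae0 => x + Dx => /(_ Dx) /= -[] /eqP; rewrite sqrf_eq0 => /eqP dx0.
congr (EFin (powR (N _) _)); apply/eqP; rewrite -subr_eq0; apply/eqP.
exact: Normc.eq0_normc dx0.
Qed.

Lemma bergman_bounded2 : bergman_bounded Omega 2.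
Proof.
exists 1; split; first exact: ltr01.
move=> f Lf _; rewrite mul1e (LpNormE _ (ltr0n _ 2)) (LpNormE f (ltr0n _ 2)).
suff : (Lpint 2 (bergman_projection Omega f) <= Lpint 2 f)%E.
  by apply: gt0_ler_poweR; rewrite ?invr_ge0// in_itv/= ?leey ?andbT Lpint_ge0.
rewrite /bergman_projection; case: xgetP => [g _ fg|_].
  exact: bergman_contraction.
(* Without a projection [xget] returns its default, the zero function, whose integral is 0. *)
rewrite Lpint2E integral0_eq ?Lpint_ge0// => x _.
by rewrite Normc.normc0 expr0n.
Qed.

End LpNorm.

(** * Projection of a truncated zero-free function *)

Section monomial_projection.
Context (R : realType) (al : R).
Local Notation C := (CC R).
Local Notation N := (@Normc.normc R).
Local Notation Omega := (hartogs al).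
Local Notation D := (real_coords (hartogs al)).
Local Notation mu := (@leb4 R).

Let mD : measurable D := measurable_hartogs al.

(** The Bergman space is stable under multiplication by [i], so orthogonality of real parts for all
    [h] yields that of imaginary parts. *)
Lemma Re_rotate (z w : C) :
  complex.Im (z * (w^*)%C) = complex.Re (z * ((('i%C : C) * w)^*)%C).
Proof. by case: z w => [a b] [c d] /=; ring. Qed.

Lemma Re_mulCr (k : R) (u v : C) :
  complex.Re ((k%:C)%C * u * ((u * v)^*)%C) = k * N u ^+ 2 * complex.Re v.
Proof. by rewrite sqr_normc_Re_Im; case: u v => [a b] [c d] /=; ring. Qed.

Lemma Lp2Z (c : C) (h : C2 R -> C) : Lp Omega 2 h -> Lp Omega 2 (fun z => c * h z).
Proof.
move=> Lh; have [hR hI] := Lh.1.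
have mch : measurable_on Omega (fun z => c * h z).
  case: c => a b; split.
    have -> : (fun x => complex.Re ((a +i* b)%C * h (toC2 x))) =
      (fun x => a * complex.Re (h (toC2 x)) - b * complex.Im (h (toC2 x))).
      by apply/funext => x; case: (h _).
    by apply: measurable_funB; apply: measurable_funM.
  have -> : (fun x => complex.Im ((a +i* b)%C * h (toC2 x))) =
    (fun x => a * complex.Im (h (toC2 x)) + b * complex.Re (h (toC2 x))).
    by apply/funext => x; case: (h _).
  by apply: measurable_funD; apply: measurable_funM.
split=> //; rewrite LpNorm_lty// Lpint2E.
have : mu.-integrable D (EFin \o (fun x => N (c * h (toC2 x)) ^+ 2)).
  apply: (Lp2_dominated mD (k := N c ^+ 2) Lh Lh).
    exact: measurable_sqr_normc mch.
  move=> x _; rewrite ger0_norm ?sqr_ge0// Normc.normcM exprMn ler_wpM2l ?sqr_ge0//.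
  by rewrite lerDl sqr_ge0.
by move=> /integrableP[_]; under eq_integral do rewrite gee0_abs ?lee_fin ?sqr_ge0//.
Qed.

Lemma bergman_spaceZ (c : C) (h : C2 R -> C) :
  bergman_space Omega h -> bergman_space Omega (fun z => c * h z).
Proof.
move=> [holh Lh]; split; last exact: Lp2Z.
by move=> z Oz; apply: (differentiableM (f := cst c)); last exact: holh.
Qed.

Variable e : C2 R -> C.
Hypothesis He : bergman_space Omega e.
Hypothesis e_neq0 : forall z, Omega z -> e z != 0.
Hypothesis e_torus : forall x s, N (e (toC2 (torus (x, s)))) = N (e (toC2 x)).
Variable P : pred R.
Hypothesis mP : measurable_fun setT (fun x : R4 R => P (N (toC2 x).2)).

(** A predicate on [|z2|] covers both truncations used later, near [z2 = 0] and away from it, and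
    keeps them torus-invariant. *)
Definition cut (z : C2 R) : C := if P (N z.2) then e z else 0.

Let chi (x : R4 R) : R := (P (N (toC2 x).2))%:R.

Let measurable_chi : measurable_fun setT chi.
Proof.
rewrite /chi; have -> : (fun x : R4 R => (P (N (toC2 x).2))%:R : R) =
  (fun x => if P (N (toC2 x).2) then 1 else 0) by apply/funext => x; case: P.
exact: measurable_fun_ifT.
Qed.

Let S : R := (\int[mu]_(x in D) (chi x * N (e (toC2 x)) ^+ 2))%R.
Let E : R := (\int[mu]_(x in D) (N (e (toC2 x)) ^+ 2))%R.

Let Le : Lp Omega 2 e := He.2.

Let integrable_weight k : mu.-integrable D
  (EFin \o (fun x => (chi x - k) * N (e (toC2 x)) ^+ 2)).
Proof.
apply: (Lp2_dominated mD (k := 1 + `|k|) Le Le).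
  apply: measurable_funM; last exact: measurable_sqr_normc Le.1.
  by apply: measurable_funB => //; exact: measurable_funTS.
move=> x _; rewrite normrM (@ger0_norm _ (_ ^+ 2)) ?sqr_ge0//.
apply: ler_pM; rewrite ?sqr_ge0//; last by rewrite lerDl sqr_ge0.
apply: (le_trans (ler_normB _ _)); rewrite lerD2r /chi.
by case: P; rewrite ?normr1 ?normr0.
Qed.

Lemma cut_Lp2 : Lp Omega 2 cut.
Proof.
have [eR eI] := Le.1.
have mcut : measurable_on Omega cut.
  split.
    have -> : (fun x => complex.Re (cut (toC2 x))) = (fun x => chi x * complex.Re (e (toC2 x))).
      by apply/funext => x; rewrite /cut /chi; case: P; rewrite ?mul1r ?mul0r.
    by apply: measurable_funM => //; exact: measurable_funTS.
  have -> : (fun x => complex.Im (cut (toC2 x))) = (fun x => chi x * complex.Im (e (toC2 x))).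
    by apply/funext => x; rewrite /cut /chi; case: P; rewrite ?mul1r ?mul0r.
  by apply: measurable_funM => //; exact: measurable_funTS.
split => //; rewrite LpNorm_lty// Lpint2E.
have : mu.-integrable D (EFin \o (fun x => N (cut (toC2 x)) ^+ 2)).
  apply: (Lp2_dominated mD (k := 1) Le Le); first exact: measurable_sqr_normc mcut.
  move=> x _; rewrite ger0_norm ?sqr_ge0// mul1r /cut; case: P.
    by rewrite lerDl sqr_ge0.
  by rewrite Normc.normc0 expr0n addr_ge0 ?sqr_ge0.
by move=> /integrableP[_]; under eq_integral do rewrite gee0_abs ?lee_fin ?sqr_ge0//.
Qed.

(** With [g = h / e] the integrand is [w] times the real part of [g], where
    [w = (chi - S / E) |e|^2]. The constant [S / E] is the one that makes the integral of [w]
    vanish. *)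
Let orth_Re h : E != 0 -> bergman_space Omega h ->
  (\int[mu]_(x in D) complex.Re
    ((cut (toC2 x) - ((S / E)%:C)%C * e (toC2 x)) * ((h (toC2 x))^*)%C))%R = 0.
Proof.
move=> E0 [holh Lh]; pose g z := h z * (e z)^-1.
have holg : holomorphic_on Omega g.
  move=> z Oz; apply: differentiableM; first exact: holh.
  by apply: differentiableV; [exact: He.1|exact: e_neq0].
(* This form exhibits the quotient as a product of functions known to be measurable. *)
have Reg x : complex.Re (g (toC2 x)) =
    complex.Re (h (toC2 x) * ((e (toC2 x))^*)%C) * (N (e (toC2 x)) ^+ 2) `^ (-1).
  rewrite powR_inv1 ?sqr_ge0// sqr_normc_Re_Im /g.
  by case: (h _) (e _) => [a b] [c d] /=; ring.
have mg : measurable_fun D (fun x => complex.Re (g (toC2 x))).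
  under eq_fun do rewrite Reg; apply: measurable_funM.
    exact: measurable_Re_dot Lh.1 Le.1.
  apply: (measurableT_comp (@measurable_powR R (-1))).
  exact: measurable_sqr_normc Le.1.
pose w x := (chi x - S / E) * N (e (toC2 x)) ^+ 2.
have iw : mu.-integrable D (EFin \o w) by exact: integrable_weight.
have weq x : D x -> complex.Re
    ((cut (toC2 x) - ((S / E)%:C)%C * e (toC2 x)) * ((h (toC2 x))^*)%C) =
    w x * complex.Re (g (toC2 x)).
  move=> Dx; have -> : h (toC2 x) = e (toC2 x) * g (toC2 x).
    by rewrite /g mulrCA divff ?mulr1//; exact: e_neq0.
  rewrite -Re_mulCr; congr (complex.Re (_ * _)).
  rewrite rmorphB mulrBl /cut /chi; case: P; first by rewrite mul1r.
  by rewrite mul0r.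
have iwg : mu.-integrable D (EFin \o (fun x => w x * complex.Re (g (toC2 x)))).
  have := integrable_Re_dot mD (Lp2B mD cut_Lp2 (bergman_spaceZ ((S / E)%:C)%C He).2) Lh.
  by apply: eq_integrable => // x /[!inE] Dx /=; rewrite weq.
pose W := w \_ D.
have WE x : (W x * complex.Re (g (toC2 x)))%:E =
    ((EFin \o (fun x => w x * complex.Re (g (toC2 x)))) \_ D) x.
  by rewrite /W !patchE; case: ifP => //; rewrite mul0r.
have intW : (\int[mu]_x (W x)%:E = 0)%E.
  rewrite (eq_integral ((EFin \o w) \_ D)); last first.
    by move=> x _; rewrite /W !patchE; case: ifP.
  rewrite -integral_mkcond -(fineK (integrable_fin_num mD iw)); congr EFin.
  have i1 := integrable_weight 0.
  rewrite -[LHS]/(\int[mu]_(x in D) w x)%R.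
  transitivity (S - S / E * E); last by rewrite divfK ?subrr.
  have ie := Lp2_integrable Le.
  rewrite /S /E -[X in _ - X]RintegralZl// -RintegralB//.
  - by apply: eq_Rintegral => x _; rewrite /w mulrBl.
  - by apply: eq_integrable i1 => // x _ /=; rewrite subr0.
  - exact: (integrableZl mD _ ie).
have Winv x s : W (torus (x, s)) = W x.
  have DE : (torus (x, s) \in D) = (x \in D).
    by apply/idP/idP; rewrite !inE => /hartogs_torus.
  by rewrite /W !patchE DE /w e_torus /chi (normc_torus x s).2.
have := @torus_invariant_integral0 R al g holg mg W _ Winv _ _ intW => key.
transitivity (\int[mu]_(x in D) (w x * complex.Re (g (toC2 x))))%R.
  by apply: eq_Rintegral => x /[!inE] Dx; rewrite weq.
rewrite /Rintegral integral_mkcond -[RHS]/(fine 0%E); congr fine; rewrite -[RHS]key.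
- by apply: eq_integral => x _; rewrite WE.
- by move=> x Dx; rewrite /W patchE memNset.
- move/(integrable_mkcond _ mD) : iw; apply: eq_integrable => // x _.
  by rewrite /W /= !patchE; case: ifP.
- move/(integrable_mkcond _ mD) : iwg; exact: eq_integrable.
Qed.

Lemma cut_projection : E != 0 ->
  is_bergman_projection Omega cut (fun z => ((S / E)%:C)%C * e z).
Proof.
move=> E0; split; first exact: bergman_spaceZ.
move=> h Hh; rewrite /L2dot /Cintegral orth_Re//.
under eq_Rintegral do rewrite Re_rotate.
by rewrite (orth_Re E0 (bergman_spaceZ 'i%C Hh)).
Qed.

End monomial_projection.

(** * Monomials and their scaling law *)

Section monomial.
Context (R : realType).
Local Notation C := (CC R).
Local Notation N := (@Normc.normc R).
Local Notation mu := (@leb4 R).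

Variables (al : R) (a m : nat).
Hypothesis al0 : 0 < al.
Local Notation Omega := (hartogs al).
Local Notation D := (real_coords (hartogs al)).

Definition mono (z : C2 R) : C := z.1 ^+ a * (z.2 ^+ m)^-1.

Let mD : measurable D := measurable_hartogs al.

Let cmeasurable (F : R4 R -> C) := measurable_fun setT (fun x => complex.Re (F x)) /\
  measurable_fun setT (fun x => complex.Im (F x)).

Let cmeasurableM F G : cmeasurable F -> cmeasurable G -> cmeasurable (fun x => F x * G x).
Proof.
move=> [FR FI] [GR GI]; split.
  have -> : (fun x => complex.Re (F x * G x)) = (fun x => complex.Re (F x) * complex.Re (G x) -
    complex.Im (F x) * complex.Im (G x)).
    by apply/funext => x; case: (F x) (G x) => [? ?] [? ?].
  by apply: measurable_funB; exact: measurable_funM.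
have -> : (fun x => complex.Im (F x * G x)) = (fun x => complex.Re (F x) * complex.Im (G x) +
  complex.Im (F x) * complex.Re (G x)).
  by apply/funext => x; case: (F x) (G x) => [? ?] [? ?].
by apply: measurable_funD; exact: measurable_funM.
Qed.

Let cmeasurableX F n : cmeasurable F -> cmeasurable (fun x => F x ^+ n).
Proof.
move=> mF; elim: n => [|n IH].
  by split; under eq_fun do rewrite expr0; exact: measurable_cst.
by under eq_fun do rewrite exprS; exact: cmeasurableM.
Qed.

Let cmeasurableV F : cmeasurable F -> cmeasurable (fun x => (F x)^-1).
Proof.
move=> [FR FI].
have mV : measurable_fun setT (fun x =>
    (complex.Re (F x) ^+ 2 + complex.Im (F x) ^+ 2) `^ (-1)).
  apply: (measurableT_comp (@measurable_powR R (-1))).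
  by apply: measurable_funD; exact: measurable_funX.
have s0 (b c : R) : 0 <= b ^+ 2 + c ^+ 2 by rewrite addr_ge0// sqr_ge0.
split.
  have -> : (fun x => complex.Re (F x)^-1) = (fun x => complex.Re (F x) *
    (complex.Re (F x) ^+ 2 + complex.Im (F x) ^+ 2) `^ (-1)).
    by apply/funext => x; rewrite powR_inv1//; case: (F x).
  exact: measurable_funM.
have -> : (fun x => complex.Im (F x)^-1) = (fun x => - complex.Im (F x) *
  (complex.Re (F x) ^+ 2 + complex.Im (F x) ^+ 2) `^ (-1)).
  by apply/funext => x; rewrite powR_inv1//; case: (F x) => b c /=; rewrite mulNr.
by apply: measurable_funM => //; exact: measurableT_comp.
Qed.

Lemma measurable_mono : measurable_on Omega mono.
Proof.
have [mR mI] : cmeasurable (fun x => mono (toC2 x)).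
  apply: cmeasurableM; [|apply: cmeasurableV]; apply: cmeasurableX; split => /=.
  - exact: measurableT_comp measurable_fst measurable_fst.
  - exact: measurableT_comp measurable_snd measurable_fst.
  - exact: measurableT_comp measurable_fst measurable_snd.
  - exact: measurableT_comp measurable_snd measurable_snd.
by split; exact: measurable_funTS.
Qed.

Lemma hartogs_neq0 z : Omega z -> z.1 != 0 /\ z.2 != 0.
Proof.
move=> [n1 n2 _ _]; split; apply/eqP => z0.
  by move: n1; rewrite z0 Normc.normc0 ltxx.
by move: n2; rewrite z0 Normc.normc0 ltxx.
Qed.

Lemma holomorphic_mono : holomorphic_on Omega mono.
Proof.
move=> z /hartogs_neq0[_ z2].
have dX (p : C2 R -> C) n : differentiable p z -> differentiable (fun z => p z ^+ n) z.
  move=> dp; case: n => [|n]; last by have := differentiableX n dp; rewrite exprfctE.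
  by have -> : (fun z => p z ^+ 0) = cst 1; [apply/funext => y; rewrite expr0|exact: differentiable_cst].
apply: differentiableM.
  apply: dX; apply: (@linear_differentiable _ _ _ fst) => y; exact: cvg_fst.
apply: differentiableV; rewrite ?expf_neq0//; apply: dX.
apply: (@linear_differentiable _ _ _ snd) => y; exact: cvg_snd.
Qed.

Lemma mono_neq0 z : Omega z -> mono z != 0.
Proof.
by move=> /hartogs_neq0[z1 z2]; rewrite mulf_neq0 ?invr_neq0 ?expf_neq0.
Qed.

Lemma normcX (z : C) n : N (z ^+ n) = N z ^+ n.
Proof.
by elim: n => [|n IH]; rewrite ?expr0 ?Normc.normc1// !exprS Normc.normcM IH.
Qed.

Lemma normc_mono z : N (mono z) = N z.1 ^+ a / N z.2 ^+ m.
Proof. by rewrite /mono Normc.normcM Normc.normcV !normcX. Qed.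

Definition degree : R := al * a%:R - m%:R.

Definition absmono (x : R4 R) : R := N (mono (toC2 x)).

Definition cutpow (q : R) (P : pred R) (x : R4 R) : R :=
  if P (N (toC2 x).2) then absmono x `^ q else 0.

Definition Mint (q : R) (P : pred R) : \bar R :=
  (\int[mu]_(x in D) (cutpow q P x)%:E)%E.

Definition mpred (P : pred R) := measurable_fun setT (fun x : R4 R => P (N (toC2 x).2)).

Lemma mpred_lt l : mpred (fun r => r < l).
Proof. by apply: measurable_fun_ltr => //; exact: (measurable_normc R).2. Qed.

Lemma mpred_ge l : mpred (fun r => l <= r).
Proof. by apply: measurable_fun_ler => //; exact: (measurable_normc R).2. Qed.

Lemma mpredI P Q : mpred P -> mpred Q -> mpred (fun r => P r && Q r).
Proof. exact: measurable_and. Qed.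

Lemma cutpow_ge0 q P x : 0 <= cutpow q P x.
Proof. by rewrite /cutpow; case: ifP; rewrite ?powR_ge0. Qed.

Lemma measurable_cutpow q P : mpred P -> measurable_fun D (cutpow q P).
Proof.
move=> mP; apply: measurable_fun_if => //.
- exact: measurable_funTS.
- apply: measurable_funS (measurable_normc_powR q measurable_mono) => //.
Qed.

Definition scaling (l : R) (x : R4 R) : R4 R :=
  ((l `^ al * x.1.1, l `^ al * x.1.2), (l * x.2.1, l * x.2.2)).

Lemma normc_scale (k b c : R) : 0 <= k -> N ((k * b) +i* (k * c))%C = k * N (b +i* c)%C.
Proof.
move=> k0; rewrite /= !exprMn -mulrDr sqrtrM ?sqr_ge0// sqrtr_sqr ger0_norm//.
Qed.

Lemma normc_scaling l x : 0 < l ->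
  N (toC2 (scaling l x)).1 = l `^ al * N (toC2 x).1 /\
  N (toC2 (scaling l x)).2 = l * N (toC2 x).2.
Proof.
by move=> l0; rewrite !normc_scale ?powR_ge0// ltW.
Qed.

Lemma scaling_dilates l : 0 < l -> dilates mu ((l `^ al) ^- 2 * l ^- 2) (scaling l).
Proof.
move=> l0; apply: (leb4_prod _ _ (leb2_scale (powR_gt0 al l0)) (leb2_scale l0)).
  by rewrite invr_ge0 exprn_ge0// powR_ge0.
by rewrite invr_ge0 exprn_ge0// ltW.
Qed.

(** Both sides of [ln |z1| < al * ln |z2|] gain [al * ln l], so this condition is preserved, while
    [|z2| < 1] turns into [|z2| < l]. *)
Lemma scaling_hartogs l x : 0 < l -> l < 1 ->
  (D (scaling l x) /\ N (toC2 (scaling l x)).2 < l) <-> D x.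
Proof.
move=> l0 l1; rewrite !real_coords_hartogsE (normc_scaling x l0).1 (normc_scaling x l0).2.
have la0 : 0 < l `^ al by exact: powR_gt0.
split=> [[[h1 h2 h3 h4] h5]|[h1 h2 h3 h4]].
  have n1 : 0 < N (toC2 x).1 by rewrite -(pmulr_rgt0 _ la0).
  have n2 : 0 < N (toC2 x).2 by rewrite -(pmulr_rgt0 _ l0).
  split=> //; move: h3 h5; rewrite !lnM ?posrE// ln_powR mulrDr ltrD2l// => _.
  by rewrite -[ltRHS]mulr1 ltr_pM2l// => n21; apply: ln_lt0; rewrite n2 n21.
have n2 : N (toC2 x).2 < 1 by rewrite -ltr_ln ?posrE// ln1.
have h5 : l * N (toC2 x).2 < l by rewrite -[ltRHS]mulr1 ltr_pM2l.
split=> //; rewrite !pmulr_rgt0// !lnM ?posrE// ln_powR; split => //.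
  by rewrite mulrDr ltrD2l.
by have := ln_lt0 (_ : 0 < l < 1); rewrite l0 l1 => /(_ isT); lra.
Qed.

Let scaling_powers (l n1 n2 : R) : 0 < l ->
  (l `^ al * n1) ^+ a / (l * n2) ^+ m = l `^ degree * (n1 ^+ a / n2 ^+ m).
Proof.
move=> l0; rewrite !exprMn invfM /degree powRD; last by rewrite (gt_eqF l0) implybT.
rewrite powRN powRrM !powR_mulrn ?powR_ge0 ?(ltW l0)//; ring.
Qed.

Lemma absmono_scaling l x : 0 < l ->
  absmono (scaling l x) = l `^ degree * absmono x.
Proof.
move=> l0; have [e1 e2] := normc_scaling x l0.
apply: etrans (normc_mono _) _.
apply: etrans (f_equal2 (fun u v => u ^+ a / v ^+ m) e1 e2) _.
apply: etrans (scaling_powers _ _ l0) _.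
exact: (f_equal (fun v => l `^ degree * v) (esym (normc_mono _))).
Qed.

Definition weight (q : R) : R := q * degree + 2 * (1 + al).

(** The integrand gains [l] to the power [q * degree], the change of variables [l] to the power
    [2 * (1 + al)]. The predicate is carried along so that truncated integrals obey the same law. *)
Lemma Mint_scale q (P : pred R) (l : R) : 0 < l -> l < 1 -> mpred P -> mpred (fun r => P (l * r)) ->
  Mint q (fun r => (r < l) && P r) =
  ((l `^ weight q)%:E * Mint q (fun r => P (l * r)%R))%E.
Proof.
move=> l0 l1 mP mPl.
pose P' r := (r < l) && P r; have mP' : mpred P' by apply: mpredI => //; exact: mpred_lt.
have mKD S : mpred S -> measurable_fun setT ((EFin \o cutpow q S) \_ D).
  move=> mS; apply/(measurable_restrict _ mD measurableT); rewrite setTI.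
  by apply/measurable_EFinP; exact: measurable_cutpow.
have KD0 S x : (0 <= ((EFin \o cutpow q S) \_ D) x)%E.
  by rewrite patchE; case: ifP => // _; rewrite lee_fin cutpow_ge0.
pose F := (EFin \o cutpow q P') \_ D; pose G := (EFin \o cutpow q (fun r => P (l * r))) \_ D.
have FG x : F (scaling l x) = ((l `^ (q * degree))%:E * G x)%E.
  rewrite /F /G !patchE.
  have [Dx|Dx] := boolP (x \in D).
    have /(scaling_hartogs x l0 l1)[Ds Nl] : D x by rewrite inE in Dx.
    rewrite mem_set// -[LHS]/(EFin (cutpow q P' (scaling l x))).
    rewrite -[X in (_ * X)%E]/(EFin (cutpow q (fun r => P (l * r)) x)).
    rewrite /cutpow /P' Nl andTb (normc_scaling x l0).2.
    rewrite -EFinM; congr EFin.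
    case: (P _); last by rewrite mulr0.
    rewrite absmono_scaling// (powRM q (powR_ge0 _ _) (normc_ge0 _)).
    by rewrite -powRrM (mulrC degree).
  rewrite mule0; case: ifP => // Ds.
  rewrite -[LHS]/(EFin (cutpow q P' (scaling l x))) /cutpow /P'.
  case: ltP => //= Nl; exfalso; move/negP : Dx; apply; rewrite inE.
  by apply/(scaling_hartogs x l0 l1); split => //; rewrite inE in Ds.
have I1E : Mint q P' = (\int[mu]_x F x)%E by rewrite /Mint integral_mkcond.
have I2E : Mint q (fun r => P (l * r)) = (\int[mu]_x G x)%E by rewrite /Mint integral_mkcond.
rewrite -/(Mint q P'); move: I1E I2E; set I1 := Mint q P'; set I2 := Mint q _ => I1E I2E.
have [_ dil] := scaling_dilates l0.
have e : ((l `^ (q * degree))%:E * I2 = ((l `^ al) ^- 2 * l ^- 2)%:E * I1)%E.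
  rewrite I1E I2E; apply: etrans (dil F (mKD _ mP') (KD0 P')).
  transitivity (\int[mu]_x ((l `^ (q * degree))%:E * G x))%E.
    have G0 x : [set: R4 R] x -> (0 <= G x)%E by move=> _; exact: KD0.
    by rewrite (ge0_integralZl mu measurableT (mKD _ mPl) G0)// lee_fin powR_ge0.
  by apply: eq_integral => x _; exact/esym/FG.
clear FG I1E I2E dil.
have la0 : 0 < l `^ al by exact: powR_gt0.
have c0 : 0 < (l `^ al) ^- 2 * l ^- 2 by rewrite mulr_gt0// invr_gt0 exprn_gt0.
have -> : I1 = (((l `^ al) ^+ 2 * l ^+ 2)%:E * (((l `^ al) ^- 2 * l ^- 2)%:E * I1))%E.
  rewrite muleA -EFinM; set k := _ * _; have -> : k = 1 :> R; last by rewrite mul1e.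
  by rewrite /k; field; rewrite !gt_eqF.
rewrite -e muleA -EFinM; congr (EFin _ * _)%E.
have lw r s : l `^ (r + s) = l `^ r * l `^ s by rewrite powRD// (gt_eqF l0) implybT.
rewrite /weight lw mulrC; congr (_ * _).
rewrite (_ : 2 * (1 + al) = al * 2%:R + 2%:R); last by ring.
by rewrite lw powRrM !powR_mulrn ?powR_ge0 ?ltW.
Qed.

Lemma Mint_split q (l : R) (P : pred R) : mpred P ->
  Mint q P = (Mint q (fun r => (r < l)%R && P r) + Mint q (fun r => (l <= r)%R && P r))%E.
Proof.
move=> mP; rewrite /Mint -ge0_integralD//.
- by apply: eq_integral => x _; rewrite /cutpow; case: ltP => _ /=; rewrite ?adde0 ?add0e.
- by move=> x _; rewrite lee_fin cutpow_ge0.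
- by apply/measurable_EFinP; apply: measurable_cutpow; apply: mpredI (mpred_lt l) mP.
- by move=> x _; rewrite lee_fin cutpow_ge0.
- by apply/measurable_EFinP; apply: measurable_cutpow; apply: mpredI (mpred_ge l) mP.
Qed.

End monomial.

(** * Finiteness and positivity of the monomial integrals *)

Section monomial_integrals.
Context (R : realType).
Local Notation C := (CC R).
Local Notation N := (@Normc.normc R).
Local Notation mu := (@leb4 R).
Local Notation mR2 := (measurableTypeR R * measurableTypeR R)%type.

Variables (al : R) (a m : nat).
Hypothesis al0 : 0 < al.
Local Notation Omega := (hartogs al).
Local Notation D := (real_coords (hartogs al)).
Local Notation K := (cutpow a m).
Local Notation M := (Mint al a m).
Local Notation w := (weight al a m).

Let mD : measurable D := measurable_hartogs al.

Let segm (b c : R) : set (measurableTypeR R) := `[b, c]%classic.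

Definition box4 (b1 c1 b2 c2 b3 c3 b4 c4 : R) : set (R4 R) :=
  (segm b1 c1 `*` segm b2 c2) `*` (segm b3 c3 `*` segm b4 c4).

Lemma measurable_box4 b1 c1 b2 c2 b3 c3 b4 c4 :
  measurable (box4 b1 c1 b2 c2 b3 c3 b4 c4).
Proof. by apply: measurableX; apply: measurableX; exact: measurable_itv. Qed.

Lemma leb4_box4 b1 c1 b2 c2 b3 c3 b4 c4 :
  b1 < c1 -> b2 < c2 -> b3 < c3 -> b4 < c4 ->
  mu (box4 b1 c1 b2 c2 b3 c3 b4 c4) =
  ((c1 - b1) * (c2 - b2) * ((c3 - b3) * (c4 - b4)))%:E.
Proof.
move=> h1 h2 h3 h4.
have seg b c : b < c -> lebesgue_measure (segm b c) = (c - b)%:E.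
  by move=> bc; rewrite lebesgue_measure_itv/= lte_fin bc -EFinB.
have msegm b c : measurable (segm b c) by exact: measurable_itv.
have sq b c b' c' : b < c -> b' < c' ->
    @leb2 R (segm b c `*` segm b' c') = ((c - b) * (c' - b'))%:E.
  by move=> bc bc'; rewrite /leb2 product_measure1E// EFinM;
    congr (_ * _)%E; exact: seg.
rewrite /leb4 /box4 product_measure1E; [|exact: measurableX..].
by rewrite EFinM; congr (_ * _)%E; exact: sq.
Qed.

Lemma hartogs_lt1 x : D x -> [/\ 0 < N (toC2 x).1, N (toC2 x).1 < 1,
  0 < N (toC2 x).2 & N (toC2 x).2 < 1].
Proof.
rewrite real_coords_hartogsE => -[n1 n2 l1 l2]; split => //.
  by rewrite -ltr_ln ?posrE// ln1 (lt_trans l1)// pmulr_rlt0.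
by rewrite -ltr_ln ?posrE// ln1.
Qed.

Lemma leb4_hartogs_lty : (mu D < +oo)%E.
Proof.
have DB : D `<=` box4 (-1) 1 (-1) 1 (-1) 1 (-1) 1.
  move=> x /hartogs_lt1[_ h1 _ h2].
  have [r1 i1] := normc_ge_Re_Im (toC2 x).1.
  have [r2 i2] := normc_ge_Re_Im (toC2 x).2.
  by do !split; rewrite /segm /= in_itv/= -ler_norml; [apply: le_trans r1 _|
    apply: le_trans i1 _|apply: le_trans r2 _|apply: le_trans i2 _]; exact: ltW.
apply: le_lt_trans (le_measure mu _ _ DB) _; rewrite ?inE//.
  exact: measurable_box4.
by rewrite [ltLHS]leb4_box4 ?ltry//; lra.
Qed.

Lemma absmono_coords x : absmono a m x = N (toC2 x).1 ^+ a / N (toC2 x).2 ^+ m.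
Proof. exact: normc_mono. Qed.

(** Here the monomial is bounded by [(l ^+ m)^-1], because [|z1| < 1], and the domain has finite
    measure. *)
Lemma Mint_shell_lty q l : 0 < l -> 0 < q -> (M q (fun r => l <= r)%R < +oo)%E.
Proof.
move=> l0 q0; pose c := (l ^+ m)^-1 `^ q.
have c0 : 0 <= c by rewrite powR_ge0.
apply: (@le_lt_trans _ _ (c%:E * mu D)%E); last first.
  rewrite -ge0_fin_numE; last by rewrite mule_ge0.
  by rewrite fin_numM// ge0_fin_numE//; exact: leb4_hartogs_lty.
rewrite -integral_cst//; apply: ge0_le_integral => //.
- by move=> x _; rewrite lee_fin cutpow_ge0.
- by apply/measurable_EFinP; apply: measurable_cutpow; exact: mpred_ge.
move=> x Dx; rewrite lee_fin /cutpow; case: ifP => // lN.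
have [n1 n11 n2 n21] := hartogs_lt1 Dx; rewrite absmono_coords.
apply: ge0_ler_powR; rewrite ?nnegrE ?invr_ge0 ?exprn_ge0 ?(ltW q0) ?(ltW l0)//.
  by rewrite divr_ge0// exprn_ge0// ltW.
rewrite -[leRHS]mul1r; apply: ler_pM.
- by rewrite exprn_ge0// ltW.
- by rewrite invr_ge0 exprn_ge0// ltW.
- by rewrite exprn_ile1// ltW.
- by rewrite lef_pV2 ?posrE ?exprn_gt0// lerXn2r// nnegrE ltW.
Qed.

Lemma Mint_shell_gt0 q : 0 < q -> (0 < M q (fun r => 2^-1 <= r)%R)%E.
Proof.
(* On the box below, [|z1| <= 2 * h], which is half of [2^-1] to the power [al], and
   [1/2 <= |z2| <= 7/8]; so the box lies in the domain. The monomial is at least [(h / 2) ^+ a]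
   there, as [|z2| < 1]. *)
move=> q0; pose h := (2^-1 : R) `^ al / 4.
have h0 : 0 < h by rewrite divr_gt0// powR_gt0// invr_gt0.
pose B := box4 (h / 2) h 0 h 2^-1 (3 / 4) 0 (1 / 8).
have BP x : B x -> [/\ D x, h / 2 <= N (toC2 x).1 & 2^-1 <= N (toC2 x).2].
  move=> [[/=]]; rewrite /segm /= !in_itv/= => /andP[x1 x1'] /andP[x2 x2'].
  move=> [] /andP[x3 x3'] /andP[x4 x4'].
  have [r1 i1] := normc_ge_Re_Im (toC2 x).1.
  have [r2 i2] := normc_ge_Re_Im (toC2 x).2.
  have s1 := normc_le_Re_Im x.1.1 x.1.2.
  have s2 := normc_le_Re_Im x.2.1 x.2.2.
  have p1 : h / 2 <= N (toC2 x).1 by apply: le_trans r1; apply: le_trans x1 (ler_norm _).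
  have p2 : 2^-1 <= N (toC2 x).2 by apply: le_trans r2; apply: le_trans x3 (ler_norm _).
  have q1 : N (toC2 x).1 <= 2 * h.
    apply: le_trans s1 _; rewrite !ger0_norm//; lra.
  have q2 : N (toC2 x).2 <= 7 / 8.
    apply: le_trans s2 _; rewrite !ger0_norm//; lra.
  split=> //; rewrite real_coords_hartogsE.
  have n1 : 0 < N (toC2 x).1 by apply: lt_le_trans p1; lra.
  have n2 : 0 < N (toC2 x).2 by apply: lt_le_trans p2; lra.
  split => //; last first.
    by apply: ln_lt0; apply/andP; split=> //; apply: (le_lt_trans q2); lra.
  apply: (@lt_le_trans _ _ (al * ln 2^-1)).
    rewrite -ln_powR ltr_ln ?posrE ?powR_gt0 ?invr_gt0//.
    by apply: le_lt_trans q1 _; rewrite /h; have := powR_gt0 al (_ : 0 < 2^-1 :> R); rewrite invr_gt0 ltr0n => /(_ isT); lra.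
  by rewrite ler_pM2l// ler_ln ?posrE ?invr_gt0.
pose c := ((h / 2) ^+ a) `^ q.
have c0 : 0 < c by rewrite powR_gt0// exprn_gt0// divr_gt0.
apply: (@lt_le_trans _ _ (c%:E * mu B)%E).
  rewrite mule_gt0 ?lte_fin// [ltRHS]leb4_box4 ?lte_fin; try lra.
  by rewrite !mulr_gt0//; lra.
have mB : measurable B by exact: measurable_box4.
rewrite -integral_cst//.
have mK : measurable_fun D (EFin \o K q (fun r => 2^-1 <= r)%R).
  by apply/measurable_EFinP; apply: measurable_cutpow; exact: mpred_ge.
have BD : B `<=` D by move=> x /BP[].
apply: (@le_trans _ _ (\int[mu]_(x in B) (K q (fun r => 2^-1 <= r)%R x)%:E)%E).
  apply: ge0_le_integral => //.
  - by move=> x _; rewrite lee_fin ltW.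
  - exact: measurable_funS mK.
  move=> x /BP[Dx p1 p2]; rewrite lee_fin /cutpow p2 absmono_coords.
  have [n1 n11 n2 n21] := hartogs_lt1 Dx.
  apply: ge0_ler_powR; rewrite ?nnegrE ?exprn_ge0 ?(ltW q0)//.
  - by rewrite divr_ge0// ltW.
  - by rewrite divr_ge0// exprn_ge0// ltW.
  rewrite -[leLHS]mulr1; apply: ler_pM => //.
  - by rewrite exprn_ge0// divr_ge0// ltW.
  - by rewrite lerXn2r// nnegrE ?divr_ge0// ltW.
  - by rewrite invf_ge1 ?exprn_gt0// exprn_ile1// ltW.
apply: ge0_subset_integral => //.
by move=> x _; rewrite lee_fin cutpow_ge0.
Qed.

Let half0 : 0 < 2^-1 :> R. Proof. by rewrite invr_gt0. Qed.
Let half1 : 2^-1 < 1 :> R. Proof. by rewrite invf_lt1// ltr1n. Qed.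

Let Mint_ge0 q P : (0 <= M q P)%E.
Proof. by apply: integral_ge0 => x _; rewrite lee_fin cutpow_ge0. Qed.

Lemma mpredT : mpred (R := R) predT.
Proof. exact: measurable_cst. Qed.

(** Splitting at [|z2| = 1/2] and rescaling gives [I = r * I + S] with [S > 0]. A nonpositive weight
    means [r >= 1], which no finite [I >= 0] satisfies. *)
Lemma Mint_infty q : 0 < q -> w q <= 0 -> M q predT = +oo%E.
Proof.
move=> q0 w0; apply/eqP; rewrite -leye_eq leNgt; apply/negP => Ioo.
have Ifin : M q predT \is a fin_num by rewrite ge0_fin_numE.
have := Mint_split al a m q 2^-1 mpredT.
rewrite (Mint_scale al a m q half0 half1 mpredT mpredT).
have -> : (fun t : R => (2^-1 <= t) && predT t) = (fun t => 2^-1 <= t).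
  by apply/funext => t; rewrite andbT.
rewrite -/predT.
have S0 := Mint_shell_gt0 q0; have Soo := Mint_shell_lty half0 q0.
have Sfin : M q (fun r => 2^-1 <= r)%R \is a fin_num by rewrite ge0_fin_numE.
rewrite -[X in (_ + X)%E](fineK Sfin) -(fineK Ifin) -EFinM -EFinD => -[].
have : 0 < fine (M q (fun r => 2^-1 <= r)%R) by rewrite fine_gt0// S0.
have : 0 <= fine (M q predT) by rewrite fine_ge0.
have : 1 <= (2^-1 : R) `^ w q.
  by rewrite -[leLHS](powRr0 2^-1); apply: ger_powR; rewrite ?half0// ltW.
move: (fine _) (fine _) (_ `^ _) => I S r r1 I0 SS; nra.
Qed.

(** The relation [I = r * I + S] is also solved by infinity, so it is used on the truncations to
    [|z2| >= 2^-n]: each is [r] times the preceding one plus [S]. With [r < 1] all stay below the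
    fixed point [S / (1 - r)], and monotone convergence concludes. *)
Lemma Mint_lty q : 0 < q -> 0 < w q -> (M q predT < +oo)%E.
Proof.
move=> q0 w0; pose r := (2^-1 : R) `^ w q.
have r0 : 0 < r by rewrite powR_gt0.
have r1 : r < 1.
  by rewrite /r /powR gt_eqF// -[ltRHS]expR0 ltr_expR pmulr_rlt0// ln_lt0// half0.
pose P n : pred R := fun t => (2^-1) ^+ n <= t.
have Soo := Mint_shell_lty half0 q0.
have Sfin : M q (fun r => 2^-1 <= r)%R \is a fin_num by rewrite ge0_fin_numE.
pose S := fine (M q (fun r => 2^-1 <= r)%R).
have S0 : 0 <= S by rewrite fine_ge0.
have PS n : (2^-1 : R) ^+ n.+1 <= 2^-1.
  by rewrite exprS -[leRHS]mulr1 ler_pM2l// exprn_ile1// ltW.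
have mP n : mpred (P n) by exact: mpred_ge.
have bound n : (M q (P n) <= (S / (1 - r))%:E)%E.
  have r10 : 0 < 1 - r by rewrite subr_gt0.
  elim: n => [|n IH].
    apply: (@le_trans _ _ S%:E).
      rewrite /S fineK//; apply: ge0_le_integral => //.
      - by move=> x _; rewrite lee_fin cutpow_ge0.
      - by apply/measurable_EFinP; apply: measurable_cutpow; exact: mpred_ge.
      - by apply/measurable_EFinP; apply: measurable_cutpow; exact: mpred_ge.
      move=> x Dx; rewrite lee_fin /cutpow /P expr0; case: ifP => h.
        by rewrite (le_trans (ltW half1) h).
      by case: ifP => _; rewrite ?powR_ge0.
    rewrite lee_fin ler_pdivlMr// -[leRHS]mulr1; apply: ler_wpM2l => //.
    by rewrite lerBlDr lerDl ltW.
  rewrite (Mint_split al a m q 2^-1 (mP n.+1)).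
  have Pn t : P n.+1 (2^-1 * t) = P n t by rewrite /P exprS ler_pM2l.
  have PE : (fun t => P n.+1 (2^-1 * t)) = P n by apply/funext => t; rewrite Pn.
  have mPE : mpred (fun t => P n.+1 (2^-1 * t)) by rewrite PE; exact: mP.
  rewrite (Mint_scale al a m q half0 half1 (mP n.+1) mPE) PE.
  have -> : (fun t => (2^-1 <= t)%R && P n.+1 t) = (fun t => 2^-1 <= t).
    apply/funext => t; rewrite /P; case: leP => //= h.
    by rewrite (le_trans (PS n) h).
  rewrite -[X in (_ + X)%E](fineK Sfin) -/S.
  apply: (@le_trans _ _ (r%:E * (S / (1 - r))%:E + S%:E)%E).
    by rewrite leeD2r// lee_pmul2l.
  rewrite -EFinM -EFinD lee_fin le_eqVlt; apply/orP; left; apply/eqP.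
  by field; rewrite gt_eqF.
apply: (@le_lt_trans _ _ (S / (1 - r))%:E); last exact: ltry.
pose f n x := (K q (P n) x)%:E.
have fmono i j x : (i <= j)%N -> (f i x <= f j x)%E.
  move=> ij; rewrite lee_fin /cutpow /P; case: ifP => h; last first.
    by case: ifP => _; rewrite ?powR_ge0.
  rewrite (le_trans _ h)//.
  by rewrite ler_wiXn2l// ltW.
(* At each point [|z2| > 0], so the truncated integrands are eventually constant. *)
have lims : (\int[mu]_(x in D) (limn (f ^~ x)) = M q predT)%E.
  apply: eq_integral => x /[!inE] Dx; apply/cvg_lim => //.
  apply: cvg_near_cst.
  have [_ _ n2 _] := hartogs_lt1 Dx.
  have [n0 n0P] := exp2_small 1 n2; exists n0 => // n /= n0n.
  by rewrite /f /cutpow /P exprVn -[_ ^- _]mul1r ltW// n0P.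
rewrite -lims monotone_convergence//.
- apply: lime_le; last by apply: nearW => n; exact: bound.
  apply: ereal_nondecreasing_is_cvgn => i j ij; apply: ge0_le_integral => //.
  + by move=> x _; rewrite lee_fin cutpow_ge0.
  + by apply/measurable_EFinP; apply: measurable_cutpow; exact: mP.
  + by apply/measurable_EFinP; apply: measurable_cutpow; exact: mP.
  + by move=> x _; exact: fmono.
- by move=> n; apply/measurable_EFinP; apply: measurable_cutpow; exact: mP.
- by move=> n x _; rewrite lee_fin cutpow_ge0.
- by move=> x _ i j ij; exact: fmono.
Qed.

Lemma Lpint_mono q : Lpint (hartogs al) q (mono a m) = M q predT.
Proof. by []. Qed.

Lemma Lpint_cut q P : 0 < q ->
  Lpint (hartogs al) q (cut (mono a m) P) = M q P.
Proof.
move=> q0; apply: eq_integral => x _; rewrite /cut /cutpow.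
by case: (P _); rewrite // Normc.normc0 powR0// gt_eqF.
Qed.

End monomial_integrals.

(** * The Hartogs triangle is a bounded domain *)

Section hartogs_domain.
Context (R : realType) (al : R).
Local Notation C := (CC R).
Local Notation N := (@Normc.normc R).
Hypothesis al0 : 0 < al.

Lemma continuous_normc : continuous (N : C -> R).
Proof.
move=> z; have FF := @nbhs_filter C z.
apply/(cvgrPdist_lt (F := nbhs z)) => e e0.
have e0' : 0 < (e%:C)%C :> C by rewrite ltCR.
apply/nbhs_normP; exists (e%:C)%C => // w zw.
have {}zw : N (z - w) < e by rewrite -ltCR -normCE.
apply: le_lt_trans zw.
have h1 := le_normcD (z - w) w; rewrite subrK in h1.
have h2 := le_normcD (w - z) z; rewrite subrK in h2.
have h3 : N (w - z) = N (z - w) by rewrite -opprB normcN.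
by rewrite ler_norml; apply/andP; split; lra.
Qed.

Lemma open_hartogs : open (hartogs al).
Proof.
rewrite openE => z [n1 n2 l1 l2].
have c1 : (fun y : C2 R => N y.1) @ z --> N z.1.
  have c : {for z, continuous (fst : C2 R -> C)} by exact: cvg_fst.
  exact: (continuous_comp c (@continuous_normc _)).
have c2 : (fun y : C2 R => N y.2) @ z --> N z.2.
  have c : {for z, continuous (snd : C2 R -> C)} by exact: cvg_snd.
  exact: (continuous_comp c (@continuous_normc _)).
have d1 : (fun y : C2 R => ln (N y.1)) @ z --> ln (N z.1).
  by apply: continuous_cvg c1; exact: continuous_ln.
have d2 : (fun y : C2 R => ln (N y.2)) @ z --> ln (N z.2).
  by apply: continuous_cvg c2; exact: continuous_ln.
have d3 : (fun y : C2 R => al * ln (N y.2) - ln (N y.1)) @ z -->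
    al * ln (N z.2) - ln (N z.1).
  by apply: cvgB => //; apply: cvgMr; exact: d2.
have FF := @nbhs_filter _ z.
have e1 := @cvgr_gt _ _ (nbhs z) FF _ _ c1 _ n1.
have e2 := @cvgr_gt _ _ (nbhs z) FF _ _ c2 _ n2.
have l1' : 0 < al * ln (N z.2) - ln (N z.1) by rewrite subr_gt0.
have e3 := @cvgr_gt _ _ (nbhs z) FF _ _ d3 _ l1'.
have e4 := @cvgr_lt _ _ (nbhs z) FF _ _ d2 _ l2.
rewrite /interior; near=> y; split.
- by near: y; exact: e1.
- by near: y; exact: e2.
- by rewrite -subr_gt0; near: y; exact: e3.
- by near: y; exact: e4.
Unshelve. all: end_near. Qed.

Lemma hartogs_nonempty : hartogs al !=set0.
Proof.
exists (cpol (- al - 1) 0, cpol (-1) 0); apply/hartogs_cpol; split; lra.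
Qed.

Lemma bounded_hartogs : bounded_set (hartogs al).
Proof.
exists 1; split; first exact: real1.
move=> x x1 z Oz.
have [n1 n2] : N z.1 < 1 /\ N z.2 < 1.
  have [n1 n2 l1 l2] := Oz; split.
    by rewrite -ltr_ln ?posrE// ln1 (lt_trans l1)// pmulr_rlt0.
  by rewrite -ltr_ln ?posrE// ln1.
apply: le_trans (ltW x1); rewrite prod_normE /Order.max; case: ifP => _;
  by rewrite normCE (leCR _ 1) ltW.
Qed.

(** By convexity of the wedge, straight segments in logarithmic polar coordinates join every point
    to a fixed one inside the domain. *)
Lemma connected_hartogs : connected (hartogs al).
Proof.
have [z0 Oz0] := hartogs_nonempty.
have [u1 [t1 [u2 [t2 [z0E [ou1 ou2]]]]]] := hartogsP Oz0.
pose line (v w : R) (x : R) := v + x * (w - v).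
have cline v w : continuous (line v w).
  by move=> x; apply: cvgD; [exact: cvg_cst|apply: cvgMl; exact: cvg_id].
have joined z : hartogs al z -> exists A : set (C2 R),
    [/\ connected A, A z0, A z & A `<=` hartogs al].
  move=> /hartogsP[v1 [s1 [v2 [s2 [zE [ov1 ov2]]]]]].
  pose G (x : R) := ((line u1 v1 x, line t1 s1 x), (line u2 v2 x, line t2 s2 x)).
  pose F (x : R) := polmap (G x).
  exists (F @` `[0, 1]%classic); split.
  - apply: connected_continuous_connected; first exact: segment_connected.
    apply: continuous_subspaceT => x.
    have cG : {for x, continuous G}.
      exact: (cvg_pair (cvg_pair (@cline u1 v1 x) (@cline t1 s1 x))
        (cvg_pair (@cline u2 v2 x) (@cline t2 s2 x))).
    exact: (continuous_comp cG (@continuous_polmap R _)).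
  - exists 0; first by rewrite /= in_itv/= lexx ler01.
    by rewrite /F /G /line !mul0r !addr0 z0E.
  - exists 1; first by rewrite /= in_itv/= lexx ler01.
    by rewrite /F /G /line !mul1r !(addrC _ (_ - _)) !subrK zE.
  - move=> y [x /=]; rewrite in_itv/= => /andP[x0 x1] <-.
    apply/hartogs_cpol; rewrite /= /line; split; last by nra.
    have : (1 - x) * (al * u2 - u1) + x * (al * v2 - v1) > 0; last by lra.
    (* The convex combination is strictly positive because at least one coefficient is; at [x = 1]
       it is the second one. *)
    have [->|xn1] := eqVneq x 1; first by rewrite subrr mul0r add0r mul1r subr_gt0.
    rewrite ltr_wpDr ?mulr_ge0 ?subr_ge0 ?(ltW ov1)// mulr_gt0 ?subr_gt0//.
    by rewrite lt_neqAle xn1.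
have -> : hartogs al = \bigcup_(A in [set A | [/\ connected A, A z0 & A `<=` hartogs al]]) A.
  apply/seteqP; split => [z /joined[A [cA A0 Az AO]]|z [A [_ _ AO] Az]].
    by exists A.
  exact: AO.
apply: bigcup_connected; last by move=> A [].
by exists z0 => A [].
Qed.

End hartogs_domain.

(** * Failure of boundedness for exponents other than 2 *)

Section unboundedness.
Context (R : realType).
Local Notation C := (CC R).
Local Notation N := (@Normc.normc R).
Local Notation mu := (@leb4 R).

(* Odd powers of [sqrt 2 - 1] are arbitrarily small positive numbers
   [sqrt 2 * y - x] with [x] and [y] natural; use them as steps from [-3]. *)
Lemma degree_dense (al := Num.sqrt 2 : R) (e : R) : 0 < e ->
  exists a m : nat, - (1 + al) < degree al a m < - (1 + al) + e.
Proof.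
move=> e0; have al2 : al ^+ 2 = 2 by rewrite sqr_sqrtr.
have al0 : 0 < al by rewrite sqrtr_gt0.
have al1 : 1 < al by nra.
have al32 : al < 3 / 2 by nra.
pose u := al - 1.
have u0 : 0 < u by rewrite /u; lra.
have u12 : u < 2^-1 by rewrite /u; lra.
have pw n : exists x y : nat, u ^+ (2 * n + 1) = al * y%:R - x%:R.
  elim: n => [|n [x [y IH]]]; first by exists 1%N, 1%N; rewrite /u mulr1.
  (* Since [u ^+ 2 = 3 - 2 * al], this is the expansion of [(3 - 2 * al) * (al * y - x)]; the new
     coefficients are again natural. *)
  exists (4 * y + 3 * x)%N, (3 * y + 2 * x)%N.
  rewrite (_ : (2 * n.+1 + 1 = 2 + (2 * n + 1))%N); last by rewrite mulnS addnA.
  rewrite exprD IH (natrD _ (4 * y)) (natrD _ (3 * y)) !natrM /u sqrrB al2 expr1n mulr1.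
  rewrite [RHS](_ : _ = al * (3 * y%:R + 2 * x%:R) - (2 * al ^+ 2 * y%:R + 3 * x%:R)).
    by ring.
  by rewrite al2; ring.
have [n nP] := exp2_small 1 e0.
have [x [y xyE]] := pw n.
set d := u ^+ _ in xyE.
have d0 : 0 < d by rewrite exprn_gt0.
have de : d < e.
  apply: le_lt_trans (nP n (leqnn _)); rewrite mul1r -exprVn.
  apply: (@le_trans _ _ (u ^+ n)).
    by rewrite /d ler_wiXn2l ?(ltW u0)//; [lra|rewrite mul2n -addnn -addnA leq_addr].
  by rewrite lerXn2r ?nnegrE ?(ltW u0) ?(ltW u12)// invr_ge0.
(* [k] is the least number of steps [d] whose sum exceeds [2 - al], the distance from -3 to
   [- (1 + al)]. The overshoot is at most [d], hence less than [e]. *)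
pose k := (Num.truncn ((2 - al) / d)).+1.
have r0 : 0 <= (2 - al) / d by rewrite divr_ge0 ?(ltW d0)//; lra.
have /andP[k1 k2] := truncn_itv r0.
exists (k * y)%N, (k * x + 3)%N.
have -> : degree al (k * y) (k * x + 3) = k%:R * d - 3.
  by rewrite /degree xyE natrD !natrM; ring.
rewrite ler_pdivlMr// in k1; rewrite ltr_pdivrMr// in k2.
have kS : k%:R = (Num.truncn ((2 - al) / d))%:R + 1 :> R by rewrite /k -natr1.
rewrite -/k in k2.
have : k%:R * d = (Num.truncn ((2 - al) / d))%:R * d + d by rewrite kS mulrDl mul1r.
by move=> kd; apply/andP; split; lra.
Qed.

Variables (al : R) (a m : nat).
Hypothesis al0 : 0 < al.
Local Notation Omega := (hartogs al).
Local Notation M := (Mint al a m).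
Local Notation w := (weight al a m).
Local Notation e := (mono a m).
Hypothesis w2 : 0 < w 2.

Let mD := measurable_hartogs al.

Let M2oo : (M 2 predT < +oo)%E. Proof. exact: Mint_lty. Qed.

Lemma bergman_space_mono : bergman_space Omega e.
Proof.
split; first exact: holomorphic_mono.
split; first exact: measurable_mono.
by rewrite LpNorm_lty// Lpint_mono.
Qed.

Lemma absmono_torus x s :
  N (e (toC2 (torus (x, s)))) = N (e (toC2 x)).
Proof.
have [e1 e2] := normc_torus x s.
apply: etrans (absmono_coords a m (torus (x, s))) _.
apply: etrans (f_equal2 (fun u v => u ^+ a / v ^+ m) e1 e2) _.
exact: esym (absmono_coords a m x).
Qed.

Let Mint_ge0 q P : (0 <= M q P)%E.
Proof. by apply: integral_ge0 => x _; rewrite lee_fin cutpow_ge0. Qed.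

Lemma Mint_gt0 q : 0 < q -> (0 < M q predT)%E.
Proof.
move=> q0; rewrite (Mint_split al a m q 2^-1 (@mpredT R)).
have -> : (fun t : R => (2^-1 <= t) && predT t) = (fun t => 2^-1 <= t).
  by apply/funext => t; rewrite andbT.
apply: lt_le_trans (leeDr _ (Mint_ge0 _ _)).
exact: Mint_shell_gt0.
Qed.

Let ratio (P : pred R) : R := fine (M 2 P) / fine (M 2 predT).

Let fineM2 : 0 < fine (M 2 predT).
Proof. by rewrite fine_gt0// M2oo andbT Mint_gt0. Qed.

(** [bergman_projection] is known only through its defining property; uniqueness lets the explicit
    multiple of [e] stand for it inside the norm. *)
Lemma LpNorm_projection_cut p P : 0 < p -> mpred P ->
  LpNorm Omega p (bergman_projection Omega (cut e P)) =
  ((ratio P)%:E * LpNorm Omega p e)%E.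
Proof.
move=> p0 mP.
have He := bergman_space_mono.
have SE : (\int[mu]_(x in real_coords Omega)
    ((P (N (toC2 x).2))%:R * N (e (toC2 x)) ^+ 2))%R = fine (M 2 P).
  congr fine; apply: eq_integral => x _; rewrite /cutpow; congr EFin.
  by case: (P _); rewrite ?mul0r// mul1r powR_mulrn// normc_ge0.
have EE : (\int[mu]_(x in real_coords Omega) (N (e (toC2 x)) ^+ 2))%R = fine (M 2 predT).
  by congr fine; rewrite -Lpint_mono Lpint2E.
have := cut_projection He (@mono_neq0 R al a m) absmono_torus mP.
rewrite SE EE => /(_ (lt0r_neq0 fineM2)) proj.
have Lcut := cut_Lp2 He mP.
rewrite (@bergman_projection_unique _ _ mD (cut e P) _ (fun z => ((ratio P)%:C)%C * e z))//.
  have r0 : 0 <= ratio P by rewrite divr_ge0// fine_ge0.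
  rewrite !LpNormE//.
  have -> : Lpint Omega p (fun z => ((ratio P)%:C)%C * e z) =
      ((ratio P `^ p)%:E * Lpint Omega p e)%E.
    rewrite /Lpint -ge0_integralZl//.
    - apply: eq_integral => x _; rewrite Normc.normcM powRM ?normc_ge0// EFinM.
      by congr (EFin (powR _ _) * _)%E; rewrite /= expr0n addr0 sqrtr_sqr ger0_norm.
    - by apply/measurable_EFinP; apply: measurable_normc_powR; exact: measurable_mono.
    - by move=> x _; rewrite lee_fin powR_ge0.
    - by rewrite lee_fin powR_ge0.
  rewrite poweRM ?lee_fin ?powR_ge0 ?Lpint_ge0//; congr (_ * _)%E.
  by rewrite poweR_EFin -powRrM divff ?gt_eqF// powRr1.
rewrite /bergman_projection; apply: xgetPex.
by exists (fun z => ((ratio P)%:C)%C * e z).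
Qed.

(** Boundedness tested on the truncations of one monomial. Those of finite [p]-integral are
    admissible, even when the monomial itself is not in [L^p]. *)
Lemma bergman_bounded_ratio p : 0 < p -> bergman_bounded Omega p ->
  exists2 c : R, 0 < c & forall P, mpred P -> (M p P < +oo)%E ->
    ((ratio P)%:E * M p predT `^ p^-1 <= c%:E * M p P `^ p^-1)%E.
Proof.
move=> p0 [c [c0 cP]]; exists c => // P mP Moo.
have Lcut := cut_Lp2 bergman_space_mono mP.
have := cP (cut e P) Lcut; rewrite LpNorm_projection_cut// !LpNormE// Lpint_cut//.
apply; split; first exact: Lcut.1.
by rewrite (LpNorm_lty _ (cut e P) p0) (Lpint_cut al a m P p0).
Qed.

Lemma bergman_unbounded_infinite p : 0 < p -> w p <= 0 -> ~ bergman_bounded Omega p.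
Proof.
move=> p0 wp /(bergman_bounded_ratio p0)[c c0 cP].
have h0 : 0 < 2^-1 :> R by rewrite invr_gt0.
have Soo := Mint_shell_lty a m al0 h0 p0.
have := cP _ (@mpred_ge R 2^-1) Soo.
rewrite (Mint_infty al0 p0 wp) poweRyr ?invr_neq0 ?gt_eqF// gt0_muley; last first.
  have S0 := Mint_shell_gt0 a m al0 (ltr0n R 2).
  have S1 := Mint_shell_lty a m al0 h0 (ltr0n R 2).
  rewrite lte_fin; apply: divr_gt0 fineM2; apply: fine_gt0.
  by apply/andP.
rewrite leye_eq => /eqP oo.
have : (c%:E * M p (fun r => 2^-1 <= r)%R `^ p^-1 < +oo)%E.
  by rewrite lte_mul_pinfty// ?lee_fin ?(ltW c0)// poweR_lty.
by rewrite oo ltxx.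
Qed.

Lemma Mint_lt q l : 0 < l -> l < 1 ->
  M q (fun r => r < l) = ((l `^ w q)%:E * M q predT)%E.
Proof.
move=> l0 l1; rewrite -(Mint_scale al a m q l0 l1 (@mpredT R) (@mpredT R)).
by congr Mint; apply/funext => t; rewrite andbT.
Qed.

Lemma bergman_unbounded_degree p : 0 < p -> 0 < w p ->
  w 2 < w p / p -> ~ bergman_bounded Omega p.
Proof.
move=> p0 wp wlt /(bergman_bounded_ratio p0)[c c0 cP].
have Ioo := Mint_lty al0 p0 wp; have I0 := Mint_gt0 p0.
pose d := w p / p - w 2.
have d0 : 0 < d by rewrite subr_gt0.
(* Chosen so that [l] to the power [d] is [(1 + c)^-1]. After cancelling the norm of [e] and [l] to
   the power [w 2], boundedness would give [1 <= c / (1 + c)]. *)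
pose l := (1 + c) `^ (- d^-1).
have c1 : 0 < 1 + c by rewrite ltr_wpDl.
have l0 : 0 < l by rewrite powR_gt0.
have l1 : l < 1.
  rewrite /l /powR gt_eqF// -[ltRHS]expR0 ltr_expR nmulr_rlt0.
    by rewrite ln_gt0// ltrDl.
  by rewrite oppr_lt0 invr_gt0.
have Mloo : (M p (fun r => r < l)%R < +oo)%E.
  by rewrite Mint_lt// lte_mul_pinfty// lee_fin powR_ge0.
have := cP _ (@mpred_lt R l) Mloo.
have -> : ratio (fun r => r < l) = l `^ w 2.
  rewrite /ratio Mint_lt// fineM//; last by rewrite ge0_fin_numE.
  by rewrite mulfK// gt_eqF.
rewrite Mint_lt// poweRM ?lee_fin ?powR_ge0// poweR_EFin -powRrM.
have Jfin : (M p predT `^ p^-1)%E \is a fin_num.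
  by rewrite ge0_fin_numE ?poweR_ge0// poweR_lty.
have J0 : 0 < fine (M p predT `^ p^-1)%E.
  by rewrite fine_gt0// poweR_gt0//= poweR_lty.
rewrite -(fineK Jfin) -!EFinM lee_fin mulrA ler_pM2r//.
rewrite (_ : w p / p = d + w 2); last by rewrite /d subrK.
have -> : l `^ (d + w 2) = l `^ d * l `^ w 2.
  by apply: powRD; rewrite (gt_eqF l0) implybT.
rewrite mulrA -[leLHS]mul1r ler_pM2r ?powR_gt0//.
rewrite /l -powRrM mulNr mulVf ?gt_eqF// powRN powRr1 ?(ltW c1)//.
by rewrite ler_pdivlMr// mul1r; lra.
Qed.

End unboundedness.

Theorem theorem1p4 (R : realType) :
  exists Omega : set (C2 R), bounded_domain Omega /\
    forall p : R, 1 < p -> (bergman_bounded Omega p <-> p = 2).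
Proof.
pose al : R := Num.sqrt 2.
have al0 : 0 < al by rewrite sqrtr_gt0.
exists (hartogs al); split.
  by split; [exact: open_hartogs|exact: connected_hartogs|
    exact: hartogs_nonempty|exact: bounded_hartogs].
move=> p p1; split=> [bp|->]; last first.
  by apply: bergman_bounded2; exact: measurable_hartogs.
have p0 : 0 < p by apply: lt_trans p1.
pose s := 1 + al; have s0 : 0 < s by exact: addr_gt0.
have [p2|p2|//] := ltgtP p 2.
  (* For a degree [t], the condition that the weight at 2 be below the weight at [p] divided by [p]
     reads [t < - s + s * (2 / p - 1)]. That the weight at [p] is positive follows from [t > - s]
     and [p < 2]. *)
  have e0 : 0 < s * (2 / p - 1).
    by apply: mulr_gt0 => //; rewrite subr_gt0 ltr_pdivlMr// mul1r.
  have [a [m /andP[t1 t2]]] := degree_dense e0.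
  rewrite -/al -/s in t1 t2.
  have w2 : 0 < weight al a m 2 by rewrite /weight -/s; lra.
  exfalso; apply: (bergman_unbounded_degree al0 w2 p0 _ _ bp).
    have : p * - s < p * degree al a m by rewrite ltr_pM2l.
    have : 0 < s * (2 - p) by rewrite mulr_gt0// subr_gt0.
    rewrite /weight -/s; lra.
  rewrite /weight -/s.
  have -> : (p * degree al a m + 2 * s) / p = degree al a m + s * (2 / p - 1) + s.
    by field; rewrite gt_eqF.
  lra.
(* For a degree [t], a nonpositive weight at [p] means [t <= - 2 * s / p], that is
   [t <= - s + s * (1 - 2 / p)]. *)
have e0 : 0 < s * (1 - 2 / p).
  by apply: mulr_gt0 => //; rewrite subr_gt0 ltr_pdivrMr// mul1r.
have [a [m /andP[t1 t2]]] := degree_dense e0.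
rewrite -/al -/s in t1 t2.
have w2 : 0 < weight al a m 2 by rewrite /weight -/s; lra.
exfalso; apply: (bergman_unbounded_infinite al0 w2 p0 _ bp).
rewrite /weight -/s; have : p * (s * (1 - 2 / p)) = p * s - 2 * s.
  by field; rewrite gt_eqF.
move: t2; rewrite -(ltr_pM2l p0) mulrDr => t2 E.
lra.
Qed.
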